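(* Let $H_1,\dots,H_k$ be finite simple graphs, where $H_1$ is the complete graph on two vertices (a single edge) and each $H_i$ contains at least one edge. Let $\beta_1,\dots,\beta_k$ be real numbers such that $\beta_2,\dots,\beta_k$ are nonnegative. Let $T(h)=\sum_{i=1}^k\beta_i\,t(H_i,h)$ for $h\in\mathcal{W}$. For each $n$, let $G_n$ be an $n$-vertex exponential random graph with sufficient statistic $T$, i.e. a random element of $\mathcal{G}_n$ with $\mathbb{P}(G_n=G)=e^{n^2(T(\widetilde{G})-\psi_n)}$ for $G\in\mathcal{G}_n$, where $\psi_n$ is the normalizing constant. Let $U\subseteq[0,1]$ be the set of maximizers of $$u\mapsto\sum_{i=1}^k\beta_iu^{e(H_i)}-I(u),\qquad 0\le u\le1,$$ where $e(H_i)$ is the number of edges of $H_i$. Then: (a) If $U=\{u^*\}$ is a single point, then $\widetilde{G}_n$ converges to (the class $\widetilde{u^*}$ of) the constant function $u^*$ in probability as $n\to\infty$, in the metric $\delta_\Box$. (b) Even if the maximizer is not unique, the set $U$ is finite and $$\min_{u\in U}\delta_\Box(\widetilde{G}_n,\widetilde{u})\to0\quad\text{in probability as }n\to\infty,$$ where $\widetilde{u}$ denotes the image in $\widetilde{\mathcal{W}}$ of the constant function $u$.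
   Context: $\mathcal{G}_n$ is the set of all simple graphs (undirected, no loops, no multiple edges) on the vertex set $\{1,\dots,n\}$. $\mathcal{W}$ is the set of all measurable functions $h:[0,1]^2\to[0,1]$ with $h(x,y)=h(y,x)$. The cut distance on $\mathcal{W}$ is $d_\Box(f,g)=\sup_{S,A\subseteq[0,1]}\left|\int_{S\times A}[f(x,y)-g(x,y)]\,dx\,dy\right|$ (supremum over measurable sets). Let $\Sigma$ be the set of measure-preserving bijections $\sigma:[0,1]\to[0,1]$ and write $g_\sigma(x,y)=g(\sigma x,\sigma y)$. For $g\in\mathcal{W}$, $\widetilde{g}$ denotes the closure in $(\mathcal{W},d_\Box)$ of the orbit $\{g_\sigma:\sigma\in\Sigma\}$; $\widetilde{\mathcal{W}}$ is the resulting quotient space, with metric $\delta_\Box(\widetilde{f},\widetilde{g})=\inf_{\sigma\in\Sigma}d_\Box(f,g_\sigma)$. For a finite simple graph $H$ with vertex set $\{1,\dots,m\}$ and edge set $E(H)$, and $h\in\mathcal{W}$, $t(H,h)=\int_{[0,1]^m}\prod_{\{i,j\}\in E(H)}h(x_i,x_j)\,dx_1\cdots dx_m$. For a simple graph $G$ on $\{1,\dots,n\}$, $f^G\in\mathcal{W}$ is defined by $f^G(x,y)=1$ if $(\lceil nx\rceil,\lceil ny\rceil)$ is an edge of $G$ and $0$ otherwise; $\widetilde{G}:=\widetilde{f^G}$, and $T(\widetilde{G})=T(f^G)=\sum_{i=1}^k\beta_it(H_i,G)$, where $t(H,G)=|\hom(H,G)|/|V(G)|^{|V(H)|}=t(H,f^G)$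 is the homomorphism density ($|\hom(H,G)|$ is the number of edge-preserving maps $V(H)\to V(G)$). The normalizing constant is $\psi_n=\frac{1}{n^2}\log\sum_{G\in\mathcal{G}_n}e^{n^2T(\widetilde{G})}$. $I(u)=\frac12u\log u+\frac12(1-u)\log(1-u)$ for $u\in[0,1]$ ($0\log0=0$). *)

(* Defs.v *)
From HB Require Import structures.
From mathcomp Require Import all_boot all_order all_algebra.
From mathcomp Require Import all_classical all_reals all_analysis.
From mathcomp Require Import measurable_realfun lra.
Set Implicit Arguments.
Unset Strict Implicit.
Unset Printing Implicit Defensive.
Import Order.TTheory GRing.Theory Num.Theory.
Import numFieldNormedType.Exports.
Local Open Scope classical_set_scope.
Local Open Scope ring_scope.

(* Edges are two-element subsets of the vertex set 'I_n; the vertex i : 'I_n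
   stands for the vertex i.+1 of {1, ..., n}. *)
Definition simple_graph (n : nat) : Type :=
  {E : {set {set 'I_n}} | [forall e in E, #|e| == 2%N]}.

HB.instance Definition _ (n : nat) := Finite.on (simple_graph n).

Definition edges n (G : simple_graph n) : {set {set 'I_n}} := val G.

Definition adj n (G : simple_graph n) (i j : 'I_n) : bool :=
  [set i; j]%SET \in edges G.

Record finite_graph := FiniteGraph {
  nvertices : nat;
  graph_of :> simple_graph nvertices }.

Definition nedges (H : finite_graph) : nat := #|edges H|.

Definition complete_edges n : {set {set 'I_n}} := [set e : {set 'I_n} | #|e| == 2%N]%SET.

Lemma complete_edgesP n : [forall e in complete_edges n, #|e| == 2%N].
Proof. by apply/forall_inP => e; rewrite inE. Qed.

Definition complete_graph n : finite_graph :=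
  FiniteGraph (exist _ (complete_edges n) (complete_edgesP n) : simple_graph n).

Lemma adj_sym n (G : simple_graph n) i j : adj G i j = adj G j i.
Proof. by rewrite /adj finset.setUC. Qed.

Lemma adj_irr n (G : simple_graph n) i : adj G i i = false.
Proof.
apply/negP; rewrite /adj finset.setUid => iG.
by have := forall_inP (valP G) _ iG; rewrite cards1.
Qed.

Section tuple_lebesgue.
Variable R : realType.
Local Notation mR := (measurableTypeR R).

Section cons_measure.
Variables (m : nat) (P : {sigma_finite_measure set (m.-tuple mR) -> \bar R}).

Definition tcons (z : mR * m.-tuple mR) : m.+1.-tuple mR :=
  [the m.+1.-tuple mR of z.1 :: z.2].

Let measurable_tcons : measurable_fun [set: mR * m.-tuple mR] tcons.
Proof. exact: measurable_cons. Qed.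

HB.instance Definition _ := isMeasurableFun.Build _ _ _ _ tcons measurable_tcons.

Definition cons_measure : set (m.+1.-tuple mR) -> \bar R :=
  pushforward (@lebesgue_measure R \x P)%E tcons.

Let cons_measure0 : cons_measure set0 = 0%E.
Proof. exact: measure0. Qed.

Let cons_measure_ge0 A : (0 <= cons_measure A)%E.
Proof. exact: measure_ge0. Qed.

Let cons_measure_sigma_additive : semi_sigma_additive cons_measure.
Proof. exact: measure_semi_sigma_additive. Qed.

HB.instance Definition _ := isMeasure.Build _ _ _ cons_measure
  cons_measure0 cons_measure_ge0 cons_measure_sigma_additive.

Let cons_measure_sigma_finite : sigma_finite setT cons_measure.
Proof.
have /sigma_finiteP[F [FT ndF Foo]] := sigma_finiteT (@lebesgue_measure R).
have /sigma_finiteP[G [GT ndG Goo]] := sigma_finiteT P.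
pose dec (t : m.+1.-tuple mR) : mR * m.-tuple mR :=
  (thead t, [tuple of behead t]).
have mdec : measurable_fun setT dec.
  by apply/measurable_fun_pairP; split;
    [exact: measurable_tnth | exact: measurable_behead].
have tconsK : cancel tcons dec.
  move=> [x t]; rewrite /dec /tcons theadE; congr pair.
  exact/val_inj.
exists (fun n => dec @^-1` (F n `*` G n)).
  apply/seteqP; split => // t _.
  have [a _ Fa] : (\bigcup_i F i) (thead t) by rewrite -FT.
  have [b _ Gb] : (\bigcup_i G i) [tuple of behead t] by rewrite -GT.
  exists (maxn a b) => //; split => /=.
    by move: Fa; exact/subsetPset/ndF/leq_maxl.
  by move: Gb; exact/subsetPset/ndG/leq_maxr.
move=> n; have [mF Fn] := Foo n; have [mG Gn] := Goo n; split.
  by rewrite -[X in measurable X]setTI; apply: mdec => //; exact: measurableX.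
rewrite /cons_measure /pushforward.
rewrite (_ : tcons @^-1` (dec @^-1` (F n `*` G n)) = F n `*` G n); last first.
  by rewrite -comp_preimage (_ : dec \o tcons = id)//; exact/funext.
by rewrite product_measure1E// lte_mul_pinfty// ge0_fin_numE.
Qed.

HB.instance Definition _ := Measure_isSigmaFinite.Build _ _ _ cons_measure
  cons_measure_sigma_finite.

End cons_measure.

(* m-dimensional Lebesgue measure, built as an iterated product measure. *)
Fixpoint lebesgue_tuple (m : nat) : {sigma_finite_measure set (m.-tuple mR) -> \bar R} :=
  if m is m'.+1 then cons_measure (lebesgue_tuple m')
  else \d_ [tuple].

End tuple_lebesgue.

Section graphons.
Variable R : realType.
Local Notation mR := (measurableTypeR R).
Local Notation mu := (@lebesgue_measure R).
Local Notation I := (`[0%R, 1%R]%classic : set mR).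

(* A graphon is a total function on R^2, constrained only on [0, 1]^2; the
   values outside the unit square are never looked at. *)
Record graphon := Graphon {
  gfun :> R -> R -> R;
  graphon_measurable :
    measurable_fun (I `*` I) (fun z : mR * mR => gfun z.1 z.2 : mR);
  graphon_itv : forall x y, I x -> I y -> 0 <= gfun x y <= 1;
  graphon_sym : forall x y, I x -> I y -> gfun x y = gfun y x }.

Definition cut_values (f g : graphon) : set R :=
  [set r | exists S A : set mR,
    [/\ measurable S, measurable A, S `<=` I, A `<=` I &
     r = `| \int[(mu \x mu)%E]_(z in S `*` A) (f z.1 z.2 - g z.1 z.2) |]].

Definition cut_dist (f g : graphon) : R := sup (cut_values f g).

(* Automorphisms of the measure space [0, 1]: the inverse is required to be
   measurable too (for a Borel bijection this is automatic). *)
Record mp_bijection := MpBijection {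
  mpfun :> R -> R;
  mp_bij : set_bij I I mpfun;
  mp_measurable : measurable_fun I (mpfun : mR -> mR);
  mp_inv_measurable :
    forall A : set mR, measurable A -> A `<=` I -> measurable (mpfun @` A : set mR);
  mp_preserving : forall A : set mR, measurable A -> A `<=` I ->
    mu (I `&` mpfun @^-1` A) = mu A }.

Lemma mp_sub (s : mp_bijection) x : I x -> I (s x).
Proof. by have [+ _ _] := mp_bij s; apply. Qed.

Lemma measurable_I2 : measurable (I `*` I : set (mR * mR)).
Proof. by apply: measurableX; exact: measurable_itv. Qed.

Definition mp_square (s : mp_bijection) (z : mR * mR) : mR * mR :=
  (patch id I (s : mR -> mR) z.1, patch id I (s : mR -> mR) z.2).

Lemma mp_squareE s x y : I x -> I y -> mp_square s (x, y) = (s x, s y).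
Proof. by move=> Ix Iy; rewrite /mp_square /= !patchT ?inE. Qed.

Lemma patch_mp_preimage s (A : set mR) :
  patch id I (s : mR -> mR) @^-1` A = (I `&` s @^-1` A) `|` (~` I `&` A).
Proof.
apply/seteqP; split => x /=; rewrite /patch; case: ifPn.
- by rewrite inE => Ix Ax; left.
- by move=> /negP Ix Ax; right; split => // Ix'; apply: Ix; rewrite inE.
- by rewrite inE => Ix [[]//|[]].
- by move=> /negP Ix [[Ix' _]|[]//]; exfalso; apply: Ix; rewrite inE.
Qed.

Lemma measurable_mp_square s : measurable_fun setT (mp_square s).
Proof.
have mI : measurable I by exact: measurable_itv.
have ms : measurable_fun setT (patch id I (s : mR -> mR)).
  move=> _ A mA; rewrite setTI patch_mp_preimage; apply: measurableU.
    exact: mp_measurable.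
  by apply: measurableI => //; exact: measurableC.
by apply: measurable_fun_pair; apply: measurableT_comp.
Qed.

Section relabel.
Variables (g : graphon) (s : mp_bijection).

Let relabel_fun (x y : R) : R := g (s x) (s y).

Let relabel_measurable :
  measurable_fun (I `*` I) (fun z : mR * mR => relabel_fun z.1 z.2 : mR).
Proof.
apply: (@eq_measurable_fun _ _ _ _ _
    ((fun z : mR * mR => g z.1 z.2 : mR) \o mp_square s)).
  by move=> [x y]; rewrite inE => -[Ix Iy]; rewrite /comp mp_squareE.
apply: (@measurable_comp _ _ _ _ _ _ (I `*` I)).
- exact: measurable_I2.
- move=> _ [[x y] [/= Ix Iy] <-]; rewrite mp_squareE//.
  by split; exact: mp_sub.
- exact: graphon_measurable.
- by apply: measurable_funTS; exact: measurable_mp_square.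
Qed.

Let relabel_itv x y : I x -> I y -> 0 <= relabel_fun x y <= 1.
Proof. by move=> Ix Iy; apply: graphon_itv; exact: mp_sub. Qed.

Let relabel_sym x y : I x -> I y -> relabel_fun x y = relabel_fun y x.
Proof. by move=> Ix Iy; apply: graphon_sym; exact: mp_sub. Qed.

Definition relabel : graphon := Graphon relabel_measurable relabel_itv relabel_sym.

End relabel.

(* The closure, in the pseudometric space of graphons, of the orbit of g. *)
Definition orbit_closure (g : graphon) : set graphon :=
  [set f | forall e : R, 0 < e ->
     exists s : mp_bijection, cut_dist f (relabel g s) < e].

Definition graphon_class : Type := {A : set graphon | range orbit_closure A}.

Definition tilde (g : graphon) : graphon_class :=
  exist _ (orbit_closure g) (imageT orbit_closure g).

Definition representative (A : graphon_class) : graphon :=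
  sval (cid2 (svalP A)).

(* The value does not depend on the representatives: see [cut_metric_tilde]. *)
Definition cut_metric (A B : graphon_class) : R :=
  inf [set cut_dist (representative A) (relabel (representative B) s)
      | s in [set: mp_bijection]].

Lemma mu_I : mu I = 1%E.
Proof. by rewrite lebesgue_measure_itv/= lte_fin ltr01 oppr0 adde0. Qed.

Lemma mu2_fin (D : set (mR * mR)) : measurable D -> D `<=` I `*` I ->
  ((mu \x mu) D <= 1)%E.
Proof.
move=> mD DI; rewrite (@le_trans _ _ ((mu \x mu)%E (I `*` I)))//.
  by apply: le_measure => //; rewrite inE//; exact: measurable_I2.
have mI : measurable I by exact: measurable_itv.
rewrite product_measure1E//.
by rewrite [X in (X * _)%E]mu_I [X in (_ * X)%E]mu_I mule1.
Qed.

Section mp_pushforward.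
Variable s : mp_bijection.

HB.instance Definition _ :=
  isMeasurableFun.Build _ _ _ _ (mp_square s) (measurable_mp_square s).

Definition mp_pushforward : set (mR * mR) -> \bar R :=
  pushforward (mu \x mu)%E (mp_square s).

Let mp_pushforward0 : mp_pushforward set0 = 0%E.
Proof. exact: measure0. Qed.

Let mp_pushforward_ge0 A : (0 <= mp_pushforward A)%E.
Proof. exact: measure_ge0. Qed.

Let mp_pushforward_sigma_additive : semi_sigma_additive mp_pushforward.
Proof. exact: measure_semi_sigma_additive. Qed.

HB.instance Definition _ := isMeasure.Build _ _ _ mp_pushforward
  mp_pushforward0 mp_pushforward_ge0 mp_pushforward_sigma_additive.

End mp_pushforward.

Lemma mp_square_preserving s (X : set (mR * mR)) : measurable X ->
  (mu \x mu)%E (mp_square s @^-1` X) = (mu \x mu)%E X.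
Proof.
move=> mX; have mI : measurable I by exact: measurable_itv.
have mC : measurable (~` I) by exact: measurableC.
have mup (A : set mR) : measurable A ->
    mu (patch id I (s : mR -> mR) @^-1` A) = mu A.
  move=> mA; rewrite patch_mp_preimage measureU//; last 3 first.
  - exact: mp_measurable.
  - exact: measurableI.
  - by apply/seteqP; split => // x [[Ix _] []].
  rewrite [in RHS](_ : A = (A `&` I) `|` (~` I `&` A)); last first.
    by rewrite [~` I `&` _]setIC -setIUr setUv setIT.
  rewrite measureU//; first last.
  - by apply/seteqP; split => // x [[_ Ix] []].
  - exact: measurableI.
  - exact: measurableI.
  congr (_ + _)%E.
  transitivity (mu (I `&` s @^-1` (A `&` I))); last first.
    by apply: mp_preserving => [|x []//]; exact: measurableI.
  congr (mu _); apply/seteqP; split => x /= [Ix sx]; split => //.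
    by split => //; exact: mp_sub.
  by case: sx.
rewrite [in RHS](@product_measure_unique _ _ _ _ _ mu mu (mp_pushforward s))// => A B mA mB.
have mpre (C : set mR) : measurable C ->
    measurable (patch id I (s : mR -> mR) @^-1` C).
  move=> mC'; rewrite patch_mp_preimage; apply: measurableU.
    exact: mp_measurable.
  exact: measurableI.
rewrite /= /mp_pushforward /pushforward.
rewrite (_ : mp_square s @^-1` (A `*` B) =
  (patch id I (s : mR -> mR) @^-1` A) `*` (patch id I (s : mR -> mR) @^-1` B))//.
rewrite product_measure1E; [|exact: mpre|exact: mpre].
by congr (_ * _)%E; exact: mup.
Qed.

Local Notation diff f g := (fun z : mR * mR => f z.1 z.2 - g z.1 z.2 : R).

Lemma diff_measurable (f g : graphon) : measurable_fun (I `*` I) (diff f g).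
Proof. by apply: measurable_funB; exact: graphon_measurable. Qed.

Lemma diff_le1 (f g : graphon) z : (I `*` I) z -> `|diff f g z| <= 1.
Proof.
case: z => x y [/= Ix Iy].
have /andP[f0 f1] := graphon_itv f Ix Iy; have /andP[g0 g1] := graphon_itv g Ix Iy.
by rewrite ler_norml; lra.
Qed.

Lemma rect_sub (S A : set mR) : S `<=` I -> A `<=` I -> S `*` A `<=` I `*` I.
Proof. by move=> SI AI [x y] [/= Sx Ay]; split; [exact: SI|exact: AI]. Qed.

Lemma diff_integrable (f g : graphon) (D : set (mR * mR)) :
  measurable D -> D `<=` I `*` I ->
  (mu \x mu)%E.-integrable D (EFin \o diff f g).
Proof.
move=> mD DI; apply: measurable_bounded_integrable => //.
- by rewrite (le_lt_trans (mu2_fin mD DI)) ?ltry.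
- by apply: measurable_funS (diff_measurable f g) => //; exact: measurable_I2.
- exists 1; split; first exact: num_real.
  move=> x x1 z Dz; apply: le_trans (ltW x1); exact/diff_le1/DI.
Qed.

Lemma cut_values_le1 (f g : graphon) r : cut_values f g r -> r <= 1.
Proof.
move=> [S [A [mS mA SI AI ->]]].
have mD : measurable (S `*` A) by exact: measurableX.
have DI := rect_sub SI AI.
apply: le_trans (le_normr_Rintegral mD (diff_integrable f g mD DI)) _.
have fin : ((mu \x mu)%E (S `*` A) < +oo)%E.
  by rewrite (le_lt_trans (mu2_fin mD DI)) ?ltry.
apply: (@le_trans _ _ (\int[(mu \x mu)%E]_(z in S `*` A) 1)).
  apply: le_Rintegral => //.
  - exact: integrable_norm (diff_integrable f g mD DI).
  - by apply: measurable_bounded_integrable => //; exact: bounded_cst.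
  - by move=> z Dz; exact/diff_le1/DI.
rewrite Rintegral_cst// mul1r -lee_fin fineK ?ge0_fin_numE//.
exact: mu2_fin.
Qed.

Lemma cut_values_nonempty (f g : graphon) : cut_values f g !=set0.
Proof. by eexists; exists set0, set0; split=> //; exact: measurable0. Qed.

Lemma cut_values_ubound (f g : graphon) : has_ubound (cut_values f g).
Proof. by exists 1 => r; exact: cut_values_le1. Qed.

Lemma cut_dist_ge0 (f g : graphon) : 0 <= cut_dist f g.
Proof.
have [r fgr] := cut_values_nonempty f g.
apply: le_trans (ub_le_sup (cut_values_ubound f g) fgr).
by case: fgr => S [A [_ _ _ _ ->]].
Qed.

Lemma cut_dist_triangle (g f h : graphon) :
  cut_dist f h <= cut_dist f g + cut_dist g h.
Proof.
apply: ge_sup (cut_values_nonempty f h) _ => _ [S [A [mS mA SI AI ->]]].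
have mD : measurable (S `*` A) by exact: measurableX.
have DI := rect_sub SI AI.
rewrite (_ : Rintegral _ _ _ = \int[(mu \x mu)%E]_(z in S `*` A) (diff f g z) +
    \int[(mu \x mu)%E]_(z in S `*` A) (diff g h z)); last first.
  rewrite -RintegralD//; [|exact: diff_integrable|exact: diff_integrable].
  by apply: eq_Rintegral => z _; rewrite addrA subrK.
apply: le_trans (ler_normD _ _) _.
by apply: lerD; apply: (ub_le_sup (cut_values_ubound _ _)); exists S, A; split.
Qed.

Lemma cut_dist_relabel (f h : graphon) s :
  cut_dist (relabel f s) (relabel h s) <= cut_dist f h.
Proof.
apply: ge_sup (cut_values_nonempty _ _) _ => _ [S [A [mS mA SI AI ->]]].
apply: (ub_le_sup (cut_values_ubound f h)); exists (s @` S), (s @` A).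
have imI (B : set mR) : B `<=` I -> s @` B `<=` I.
  by move=> BI _ [x Bx <-]; exact/mp_sub/BI.
split; [exact: mp_inv_measurable|exact: mp_inv_measurable|exact: imI|exact: imI|].
have mI2 := measurable_I2.
pose w : mR * mR -> R := (diff f h : mR * mR -> R) \_ (I `*` I).
have mw : measurable_fun setT w.
  apply/(measurable_restrict _ mI2 measurableT).
  by rewrite setTI; exact: diff_measurable.
pose D' : set (mR * mR) := (s @` S : set mR) `*` (s @` A : set mR).
have mD' : measurable D' by apply: measurableX; exact: mp_inv_measurable.
have D'I : D' `<=` I `*` I by apply: rect_sub; exact: imI.
have injs x y : I x -> I y -> s x = s y -> x = y.
  by have [_ + _] := mp_bij s => inj Ix Iy; apply: inj; rewrite inE.
have preD' : mp_square s @^-1` D' = S `*` A.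
  apply/seteqP; split => [[x y]|[x y] [/= Sx Ay]]; last first.
    rewrite /preimage /= mp_squareE; [|exact: SI|exact: AI].
    by split; [exists x|exists y].
  have p (B : set mR) t : B `<=` I -> (s @` B) (patch id I (s : mR -> mR) t) -> B t.
    move=> BI [b Bb]; rewrite /patch; case: ifPn => [|/negP tI bt].
      by rewrite inE => It /(injs _ _ (BI _ Bb) It) <-.
    by exfalso; apply: tI; rewrite inE -bt; exact/mp_sub/BI.
  by move=> [/= xS yA]; split; [exact: p xS|exact: p yA].
congr `|_|; rewrite /Rintegral; congr fine.
pose we : mR * mR -> \bar R := EFin \o w.
have mw' : measurable_fun setT we by apply/measurable_EFinP.
have wE : {in S `*` A, we \o mp_square s =1
    EFin \o diff (relabel f s) (relabel h s)}.
  move=> [x y]; rewrite inE => -[/= /SI Ix /AI Iy].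
  rewrite /= mp_squareE// /we /w /= patchT// inE; split; exact: mp_sub.
have iw : (mu \x mu)%E.-integrable (mp_square s @^-1` D')
    (we \o mp_square s).
  rewrite preD'; apply: (@eq_integrable _ _ _ _ _ _ (EFin \o diff (relabel f s) (relabel h s))).
  + exact: measurableX.
  + by move=> z zD; rewrite wE.
  + by apply: diff_integrable; [exact: measurableX|exact: rect_sub].
have IP := integral_pushforward (measurable_mp_square s) mw' iw mD'.
rewrite preD' in IP.
transitivity (\int[pushforward (mu \x mu)%E (mp_square s)]_(y in D') we y)%E.
  by rewrite IP; apply: eq_integral => z zD; rewrite wE.
transitivity (\int[(mu \x mu)%E]_(y in D') we y)%E.
  apply: (@eq_measure_integral _ _ _ _ (mu \x mu)%E (mp_pushforward s)) => B mB _.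
  exact: mp_square_preserving.
apply: eq_integral => z zD.
have zI : z \in I `*` I by apply/mem_set/D'I; exact: set_mem.
by congr EFin; rewrite /w (patchT _ _ zI).
Qed.

Definition mp_id : mp_bijection.
Proof.
exists id.
- by split => [x //|x y _ _ //|x Ix]; exists x.
- exact: measurable_id.
- by move=> A mA _; rewrite image_id.
- by move=> A mA AI; rewrite preimage_id setIidr.
Defined.

Definition mp_comp (s t : mp_bijection) : mp_bijection.
Proof.
exists (s \o t).
- exact: set_bij_comp (mp_bij t) (mp_bij s).
- apply: (@measurable_comp _ _ _ _ _ _ I).
  + exact: measurable_itv.
  + by move=> _ [x Ix <-]; exact: mp_sub.
  + exact: mp_measurable.
  + exact: mp_measurable.
- move=> A mA AI; rewrite -image_comp; apply: mp_inv_measurable.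
    exact: mp_inv_measurable.
  by move=> _ [x Ax <-]; exact/mp_sub/AI.
- move=> A mA AI.
  transitivity (mu (I `&` s @^-1` A)); last exact: mp_preserving.
  transitivity (mu (I `&` t @^-1` (I `&` s @^-1` A))); last first.
    by apply: mp_preserving => [|x []//]; apply: mp_measurable => //; exact: measurable_itv.
  congr (mu _); apply/seteqP; split => x /= [Ix].
    by move=> Ax; split => //; split => //; exact: mp_sub.
  by move=> [].
Defined.

Lemma relabel_id g : relabel g mp_id = g.
Proof. by case: g => g p q r; congr Graphon; exact: Prop_irrelevance. Qed.

Lemma relabel_comp g s t : relabel (relabel g s) t = relabel g (mp_comp s t).
Proof. by congr Graphon; exact: Prop_irrelevance. Qed.

Lemma cut_dist_xx f : cut_dist f f = 0.
Proof.
apply/le_anti; rewrite cut_dist_ge0 andbT.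
apply: ge_sup (cut_values_nonempty f f) _ => _ [S [A [mS mA _ _ ->]]].
under eq_Rintegral do rewrite subrr.
by rewrite Rintegral_cst ?mul0r ?normr0//; exact: measurableX.
Qed.

Lemma cut_dist_sym f g : cut_dist f g = cut_dist g f.
Proof.
suff le (h k : graphon) : cut_dist h k <= cut_dist k h by apply/le_anti; rewrite !le.
apply: ge_sup (cut_values_nonempty h k) _ => _ [S [A [mS mA SI AI ->]]].
apply: (ub_le_sup (cut_values_ubound k h)); exists S, A; split => //.
have mD : measurable (S `*` A) by exact: measurableX.
rewrite -normrN -mulN1r -RintegralZl//; last exact/diff_integrable/rect_sub.
by congr `|_|; apply: eq_Rintegral => z _; rewrite mulN1r opprB.
Qed.

Lemma tilde_representative A : tilde (representative A) = A.
Proof.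
rewrite /representative; case: A => A HA /=; case: cid2 => g _ /= gA.
by apply: eq_exist.
Qed.

Lemma orbit_closure_self g : orbit_closure g g.
Proof. by move=> e e0; exists mp_id; rewrite relabel_id cut_dist_xx. Qed.

Lemma cut_metric_tilde (f g : graphon) :
  cut_metric (tilde f) (tilde g) =
  inf [set cut_dist f (relabel g s) | s in [set: mp_bijection]].
Proof.
have lb (h k : graphon) :
    has_lbound [set cut_dist h (relabel k s) | s in [set: mp_bijection]].
  by exists 0 => _ [s _ <-]; exact: cut_dist_ge0.
have ne (h k : graphon) :
    [set cut_dist h (relabel k s) | s in [set: mp_bijection]] !=set0.
  by exists (cut_dist h (relabel k mp_id)), mp_id.
have le (f1 g1 f2 g2 : graphon) : tilde f1 = tilde f2 -> tilde g1 = tilde g2 ->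
    inf [set cut_dist f1 (relabel g1 s) | s in [set: mp_bijection]] <=
    inf [set cut_dist f2 (relabel g2 s) | s in [set: mp_bijection]].
  move=> /(congr1 sval) /= ff /(congr1 sval) /= gg.
  apply: lb_le_inf (ne _ _) _ => _ [s _ <-].
  apply/ler_addgt0Pr => e e0; have e20 : 0 < e / 2 by rewrite divr_gt0.
  have [r fr] : exists r, cut_dist f1 (relabel f2 r) < e / 2.
    by move: (orbit_closure_self f1); rewrite ff => /(_ _ e20).
  have [t gt] : exists t, cut_dist g2 (relabel g1 t) < e / 2.
    by move: (orbit_closure_self g2); rewrite -gg => /(_ _ e20).
  apply: le_trans (_ : cut_dist f1 (relabel g1 (mp_comp t (mp_comp s r))) <= _).
    by apply: (ge_inf (lb f1 g1)); exists (mp_comp t (mp_comp s r)).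
  rewrite -relabel_comp -relabel_comp.
  have h1 := cut_dist_triangle (relabel f2 r) f1
    (relabel (relabel (relabel g1 t) s) r).
  have h2 := cut_dist_relabel f2 (relabel (relabel g1 t) s) r.
  have h3 := cut_dist_triangle (relabel g2 s) f2 (relabel (relabel g1 t) s).
  have h4 := cut_dist_relabel g2 (relabel g1 t) s.
  lra.
by apply/le_anti/andP; split; apply: le; rewrite tilde_representative.
Qed.

End graphons.

Section densities.
Variable R : realType.
Local Notation mR := (measurableTypeR R).
Local Notation I := (`[0%R, 1%R]%classic : set mR).

Section const_graphon.
Variable u : {i01 R}.

Let const_measurable :
  measurable_fun (I `*` I) (fun z : mR * mR => (fun _ _ : R => u%:num) z.1 z.2 : mR).
Proof. exact: measurable_cst. Qed.

Let const_itv (x y : R) : I x -> I y -> 0 <= (fun _ _ : R => u%:num) x y <= 1.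
Proof. by move=> _ _; rewrite /= ge0 le1. Qed.

Definition const_graphon : graphon R :=
  Graphon const_measurable const_itv (fun _ _ _ _ => erefl).

End const_graphon.

Section graph_graphon.
Variables (n : nat) (G : simple_graph n).

Definition graph_fun (x y : R) : R :=
  [exists i : 'I_n, exists j : 'I_n,
    [&& adj G i j, Num.ceil (n%:R * x) == i.+1%:Z
      & Num.ceil (n%:R * y) == j.+1%:Z]]%:R.

Let graph_fun_measurable :
  measurable_fun (I `*` I) (fun z : mR * mR => graph_fun z.1 z.2 : mR).
Proof.
pose B (i : 'I_n) : set mR := [set x : R | Num.ceil (n%:R * x) == i.+1%:Z].
have mB i : measurable (B i).
  have -> : B i = (fun x : mR => n%:R * x : mR) @^-1` `](i.+1%:Z - 1)%:~R, i.+1%:~R].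
    by apply/seteqP; split => x; rewrite /B /= ceil_eq in_itv.
  rewrite -[X in measurable X]setTI.
  by apply: (mulrl_measurable _) => //; exact: measurable_itv.
pose D : set (mR * mR) := \big[setU/set0]_(p : 'I_n * 'I_n | adj G p.1 p.2)
  (B p.1 `*` B p.2).
have mD : measurable D by apply: bigsetU_measurable => p _; exact: measurableX.
have -> : (fun z : mR * mR => graph_fun z.1 z.2 : mR) = \1_D.
  apply/funext => z; rewrite /graph_fun indicE; congr (nat_of_bool _)%:R.
  apply/existsP/idP => [[i /existsP[j /and3P[ij xi yj]]]|].
    by rewrite inE /D -bigcup_seq_cond; exists (i, j); rewrite /= ?mem_index_enum.
  rewrite inE /D -bigcup_seq_cond => -[[i j] /= /andP[_ ij] [xi yj]].
  by exists i; apply/existsP; exists j; apply/and3P.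
exact: measurable_indic.
Qed.

Let graph_fun_itv (x y : R) : I x -> I y -> 0 <= graph_fun x y <= 1.
Proof. by move=> _ _; rewrite ler0n lern1 leq_b1. Qed.

Let graph_fun_sym (x y : R) : I x -> I y -> graph_fun x y = graph_fun y x.
Proof.
move=> _ _; congr (nat_of_bool _)%:R; apply/existsP/existsP => -[i /existsP[j]];
by case/and3P=> ij xi yj; exists j; apply/existsP; exists i; rewrite adj_sym ij xi yj.
Qed.

Definition graph_graphon : graphon R :=
  Graphon graph_fun_measurable graph_fun_itv graph_fun_sym.

End graph_graphon.

(* The condition i < j makes every edge {i, j} of H contribute exactly once. *)
Definition hom_density (H : finite_graph) (h : graphon R) : R :=
  \int[lebesgue_tuple R (nvertices H)]_(x in
      [set x : (nvertices H).-tuple mR | forall i, I (tnth x i)])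
    \prod_(i < nvertices H) \prod_(j < nvertices H | (i < j)%N && adj H i j)
      h (tnth x i) (tnth x j).

End densities.

Section ergm.
Variables (R : realType) (k : nat) (H : 'I_k -> finite_graph) (beta : 'I_k -> R).

Definition statistic (h : graphon R) : R :=
  \sum_(i < k) beta i * hom_density (H i) h.

Definition normalizing_constant (n : nat) : R :=
  (n%:R ^+ 2)^-1 *
  ln (\sum_(G : simple_graph n) expR (n%:R ^+ 2 * statistic (graph_graphon R G))).

Definition exponential_random_graph n d (Omega : measurableType d)
    (P : probability Omega R) (G : Omega -> simple_graph n) : Prop :=
  forall g : simple_graph n, measurable (G @^-1` [set g]) /\
    P (G @^-1` [set g]) =
    (expR (n%:R ^+ 2 * (statistic (graph_graphon R g) - normalizing_constant n)))%:E.

(* [ln 0 = 0] in the library, in agreement with 0 log 0 = 0. *)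
Definition rate (u : R) : R := 2^-1 * u * ln u + 2^-1 * (1 - u) * ln (1 - u).

Definition scalar_objective (u : R) : R :=
  \sum_(i < k) beta i * u ^+ nedges (H i) - rate u.

Definition maximizers : set {i01 R} :=
  [set u | forall v : {i01 R}, scalar_objective v%:num <= scalar_objective u%:num].

End ergm.

Definition cvg0_in_probability (R : realType) (d : nat -> measure_display)
    (Omega : forall n, measurableType (d n)) (P : forall n, probability (Omega n) R)
    (X : forall n, Omega n -> R) : Prop :=
  forall e : R, 0 < e ->
    P n [set w | e < `|X n w|] @[n --> \oo] --> 0%E.

(* Main.v *)
Require Import Defs.
From mathcomp Require Import all_boot all_order all_algebra.
From mathcomp Require Import all_classical all_reals all_analysis.
From mathcomp Require Import measurable_realfun zify ring lra.
Set Implicit Arguments.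
Unset Strict Implicit.
Unset Printing Implicit Defensive.
Import Order.TTheory GRing.Theory Num.Theory.
Local Open Scope ring_scope.

(** Let [L] be the maximum over [0 <= u <= 1] of the scalar objective
    [sum_i beta_i u ^ e(H_i) - I(u)], and [U] the set of its maximizers.

    Lower bound: the partition function is at least [exp (n^2 L - O(n))].  This
    is the Gibbs variational inequality, that is Jensen's inequality, tested on
    a random graph with independent edges whose probability is a maximizer
    ([partition_function_ge]).

    Upper bound: the graphs at cut distance more than [e] from every constant of
    [U] have total weight at most [exp (n^2 (L - delta) + O(n))]
    ([sum_far_graphs_le]).  Each such graph [G] is replaced by its block averages
    [W] over a colouring of the vertices with a bounded number of colours, given
    by the Frieze-Kannan regularity lemma ([weak_regularity]); the counting lemma
    then says that [T(G)] and [T(W)] are close ([counting_lemma]).  The entropy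
    comes from a comparison of laws: [exp (n^2 mean I(W))] is at most the
    probability of [G] under independent edges with probabilities [W]
    ([expR_rate_le_edge_law]).  A law has mass one and there are only
    [exp (O(n))] possible [W], so these terms sum up to at most [exp (O(n))]
    ([sum_edge_law_profile_le]).  What is left is the factor
    [exp (n^2 (T(W) - mean I(W)))].

    Stability: if [T(W) - mean I(W) >= L - delta] then [W] is close in mean to
    one constant of [U] ([near_maximizer_near_constant]).  The
    arithmetic-geometric inequality on the edges of [H] gives
    [t(H, W) <= mean W ^ e(H)], with equality for a single edge, which is why
    [beta_1] may be negative.  Hence [T(W) - mean I(W)] is at most the mean of
    the scalar objective over the values of [W], and nearly all these values lie
    near [U].  If [U] is a single point, this is the claim.  If not, some [H_i]
    with two edges has a positive weight, for otherwise the scalar objective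
    would be strictly concave ([is_max_unique]); the deficit of the
    arithmetic-geometric inequality bounds the difference of the values of [W]
    on two edges of [H_i], hence on two independent pairs ([two_edges]), so the
    values lie near the same point of [U].

    Dividing, the probability of being far from [U] is at most
    [exp (O(n) - delta n^2)].  The set [U] is finite because two maximizers
    inside the interval are separated by a root of a fixed nonzero polynomial
    ([finite_is_max]). *)

(** * Means over finite sets *)

Section mean.
Variable R : realType.

Definition mean (T : finType) (f : T -> R) : R := #|T|%:R^-1 * \sum_x f x.

Lemma eq_mean (T : finType) (f g : T -> R) : f =1 g -> mean f = mean g.
Proof. by move=> fg; congr (_ * _); apply: eq_bigr => x _. Qed.

Lemma ler_mean (T : finType) (f g : T -> R) :
  (forall x, f x <= g x) -> mean f <= mean g.
Proof. by move=> fg; rewrite ler_wpM2l ?invr_ge0 ?ler0n// ler_sum. Qed.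

Lemma mean_cst (T : finType) (a : R) : (0 < #|T|)%N -> mean (fun _ : T => a) = a.
Proof.
move=> T0; rewrite /mean sumr_const -[a *+ _]mulr_natl mulrA mulVf ?mul1r//.
by rewrite pnatr_eq0 -lt0n.
Qed.

Lemma meanD (T : finType) (f g : T -> R) :
  mean (fun x => f x + g x) = mean f + mean g.
Proof. by rewrite /mean big_split mulrDr. Qed.

Lemma meanZ (T : finType) a (f : T -> R) : mean (fun x => a * f x) = a * mean f.
Proof. by rewrite /mean -mulr_sumr mulrCA. Qed.

Lemma meanB (T : finType) (f g : T -> R) :
  mean (fun x => f x - g x) = mean f - mean g.
Proof. by rewrite /mean sumrB mulrBr. Qed.

Lemma mean_sum (T I : finType) (f : I -> T -> R) :
  mean (fun x => \sum_i f i x) = \sum_i mean (f i).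
Proof. by rewrite /mean exchange_big /= mulr_sumr. Qed.

Lemma ler_norm_mean (T : finType) (f : T -> R) : `|mean f| <= mean (fun x => `|f x|).
Proof.
by rewrite /mean normrM ger0_norm ?invr_ge0 ?ler0n// ler_wpM2l ?invr_ge0 ?ler0n// ler_norm_sum.
Qed.

Lemma mean_ge0 (T : finType) (f : T -> R) : (forall x, 0 <= f x) -> 0 <= mean f.
Proof. by move=> f0; rewrite mulr_ge0 ?invr_ge0 ?ler0n ?sumr_ge0. Qed.

Lemma mean_lt_ex (T : finType) (f : T -> R) a : (0 < #|T|)%N ->
  mean f < a -> exists x, f x < a.
Proof.
move=> T0 fa; apply: contrapT => /forallNP h.
move: fa; rewrite ltNge => /negP; apply.
rewrite -[leLHS](@mean_cst T a)//; apply: ler_mean => x.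
by rewrite leNgt; apply/negP.
Qed.

Lemma mean_pair (S T : finType) (f : S * T -> R) :
  mean f = mean (fun x => mean (fun y => f (x, y))).
Proof.
rewrite /mean card_prod natrM invfM -mulrA; congr (_ * _).
by rewrite -mulr_sumr pair_bigA; congr (_ * _); apply: eq_bigr => -[].
Qed.

Lemma mean_exchange (S T : finType) (f : S -> T -> R) :
  mean (fun x => mean (f x)) = mean (fun y => mean (f^~ y)).
Proof.
rewrite /mean -mulr_sumr [in RHS]mulrC -[in RHS]mulr_sumr exchange_big.
by rewrite /=; ring.
Qed.

Lemma mean_bij (S T : finType) (h : S -> T) (f : T -> R) :
  bijective h -> mean f = mean (f \o h).
Proof.
by move=> bh; rewrite /mean (reindex h) ?(bij_eq_card bh)//; exact: onW_bij.
Qed.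

Section resample.
Variables (I T : finType).

Definition upd (phi : {ffun I -> T}) a x : {ffun I -> T} :=
  [ffun i => if i == a then x else phi i].

Lemma updE phi a x i : upd phi a x i = if i == a then x else phi i.
Proof. by rewrite ffunE. Qed.

(** Swapping the value at [a] with an independent one is an involution of the
    pairs (map, value), hence it preserves means. *)
Lemma mean_resample (a : I) (F : {ffun I -> T} -> R) : (0 < #|T|)%N ->
  mean F = mean (fun phi => mean (fun x => F (upd phi a x))).
Proof.
move=> T0; pose sw (p : {ffun I -> T} * T) := (upd p.1 a p.2, p.1 a).
have swK : involutive sw.
  move=> [phi x]; rewrite /sw /= updE eqxx; congr pair.
  by apply/ffunP => i; rewrite !updE; case: eqP => // ->.
rewrite -(mean_pair (fun p => F (upd p.1 a p.2))).
rewrite (mean_bij _ (inv_bij swK)) mean_pair; apply: eq_mean => phi.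
rewrite -[LHS](@mean_cst T)//; apply: eq_mean => x /=; congr F.
by apply/ffunP => i; rewrite !updE; case: eqP => // ->.
Qed.

End resample.

Lemma mean_marginal2 (I T : finType) (a b : I) (g : T -> T -> R) :
  (0 < #|T|)%N -> a != b ->
  mean (fun phi : {ffun I -> T} => g (phi a) (phi b)) =
  mean (fun x => mean (fun y => g x y)).
Proof.
move=> T0 ab; rewrite (mean_resample a)// (mean_resample b)//.
transitivity (mean (fun phi : {ffun I -> T} => mean (fun y => mean (fun x => g x y)))).
  apply: eq_mean => phi; apply: eq_mean => y; apply: eq_mean => x.
  by rewrite !updE eqxx [b == a]eq_sym (negbTE ab) eqxx.
rewrite mean_cst; last by rewrite card_ffun expn_gt0 T0.
exact: mean_exchange.
Qed.

End mean.

(** * Cut norm and homomorphism densities *)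

Section counting.
Variable R : realType.

Definition unit_valued (T : Type) (f : T -> R) := forall x, 0 <= f x <= 1.

Lemma prod_unit (I : Type) (r : seq I) (P : pred I) (F : I -> R) :
  unit_valued F -> 0 <= \prod_(i <- r | P i) F i <= 1.
Proof.
move=> F01; elim/big_ind: _ => [|x y /andP[x0 x1] /andP[y0 y1]|i _]; last exact: F01.
  by rewrite ler01 lexx.
by rewrite mulr_ge0//= -[leRHS]mulr1 ler_pM.
Qed.

(** The cut norm, divided by [n ^ 2].  Tests are functions rather than sets:
    both the products left over in the counting lemma and the measures of the
    traces of a set on the cells of the unit interval are admissible. *)
Definition cut_le (n : nat) (D : 'I_n -> 'I_n -> R) (e : R) :=
  forall f g : 'I_n -> R, unit_valued f -> unit_valued g ->
    `|mean (fun i => mean (fun j => D i j * (f i * g j)))| <= e.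

Definition edge_pairs (H : finite_graph) : {set 'I_(nvertices H) * 'I_(nvertices H)} :=
  [set p : 'I_(nvertices H) * 'I_(nvertices H) | (p.1 < p.2)%N && adj H p.1 p.2].

Definition hom_mean (H : finite_graph) n (W : 'I_n -> 'I_n -> R) : R :=
  mean (fun phi : {ffun 'I_(nvertices H) -> 'I_n} =>
    \prod_(p in edge_pairs H) W (phi p.1) (phi p.2)).

(** Freeze all vertices but the two ends of the edge [k]: no other edge
    contains both ends, so the remaining factors split into a function of one
    end times a function of the other one, and the cut norm applies. *)
Lemma cut_le_edge (m n : nat) (D : 'I_n -> 'I_n -> R) (e : R) (k : 'I_m * 'I_m)
    (s : seq ('I_m * 'I_m)) (M : 'I_m * 'I_m -> 'I_n -> 'I_n -> R) :
  (0 < n)%N -> (forall l i j, 0 <= M l i j <= 1) -> (k.1 < k.2)%N ->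
  {in s, forall l : 'I_m * 'I_m, (l.1 < l.2)%N && (l != k)} -> cut_le D e ->
  `|mean (fun phi : {ffun 'I_m -> 'I_n} => D (phi k.1) (phi k.2) *
      \prod_(l <- s) M l (phi l.1) (phi l.2))| <= e.
Proof.
case: k => a b /= n0 M01 ab sP De.
have In0 : (0 < #|'I_n|)%N by rewrite card_ord.
have ba : (b == a) = false by apply/eqP => ba; move: ab; rewrite ba ltnn.
rewrite (mean_resample a)// (mean_resample b)//.
apply: le_trans (ler_norm_mean _) _.
rewrite -[leRHS](@mean_cst _ {ffun 'I_m -> 'I_n}); last by rewrite card_ffun expn_gt0 In0.
apply: ler_mean => phi; rewrite mean_exchange.
pose at_a (l : 'I_m * 'I_m) := (l.1 == a) || (l.2 == a).
pose F (c : 'I_m) x (l : 'I_m * 'I_m) := M l (upd phi c x l.1) (upd phi c x l.2).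
have F01 c x : unit_valued (F c x) by move=> l; exact: M01.
rewrite (_ : mean _ = mean (fun x => mean (fun y => D x y *
    ((\prod_(l <- s | at_a l) F a x l) * (\prod_(l <- s | ~~ at_a l) F b y l))))).
  by apply: De => x; exact: prod_unit.
apply: eq_mean => x; apply: eq_mean => y.
pose phi' := upd (upd phi b y) a x.
have Ea : \prod_(l <- s | at_a l) M l (phi' l.1) (phi' l.2) = \prod_(l <- s | at_a l) F a x l.
  rewrite big_seq_cond [RHS]big_seq_cond; apply: eq_bigr => -[l1 l2] /andP[ls la].
  have /andP[/= l12 lk] := sP _ ls.
  have lb : (l1 != b) && (l2 != b).
    move: la; rewrite /at_a /=; case: eqP => [l1a _|_ /= /eqP l2a].
      rewrite l1a [a == b]eq_sym ba /=; apply: contra lk => /eqP ->.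
      by rewrite l1a.
    rewrite l2a [a == b]eq_sym ba andbT; apply/eqP => l1b.
    by move: l12; rewrite l1b l2a ltnNge ltnW.
  move/andP: lb => [/negbTE lb1 /negbTE lb2].
  by rewrite /F /phi' /= !updE lb1 lb2.
have Eb : \prod_(l <- s | ~~ at_a l) M l (phi' l.1) (phi' l.2) =
    \prod_(l <- s | ~~ at_a l) F b y l.
  apply: eq_bigr => -[l1 l2]; rewrite /at_a /= negb_or => /andP[/negbTE la1 /negbTE la2].
  by rewrite /F /phi' /= !updE la1 la2.
by rewrite (bigID at_a) /= Ea Eb /phi' !updE eqxx ba eqxx.
Qed.

(** The factors are replaced one edge at a time, at a cost [e] each. *)
Lemma counting_lemma (H : finite_graph) n (A W : 'I_n -> 'I_n -> R) e :
  (0 < n)%N -> (forall i j, 0 <= A i j <= 1) -> (forall i j, 0 <= W i j <= 1) ->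
  cut_le (fun i j => A i j - W i j) e ->
  `|hom_mean H A - hom_mean H W| <= #|edge_pairs H|%:R * e.
Proof.
move=> n0 A01 W01 AWe; set m := nvertices H.
pose fac (B : 'I_n -> 'I_n -> R) (phi : {ffun 'I_m -> 'I_n}) (p : 'I_m * 'I_m) :=
  B (phi p.1) (phi p.2).
(* edges in [s1] already carry [W], those in [s2] still carry [A] *)
suff hyb (s1 s2 : seq ('I_m * 'I_m)) : uniq (s1 ++ s2) ->
    {in s1 ++ s2, forall l : 'I_m * 'I_m, (l.1 < l.2)%N} ->
    `|mean (fun phi => (\prod_(p <- s1) fac W phi p) * \prod_(p <- s2) fac A phi p)
      - mean (fun phi => \prod_(p <- s1 ++ s2) fac W phi p)| <= (size s2)%:R * e.
  have := hyb [::] (enum (edge_pairs H)) (enum_uniq _).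
  rewrite -cardE /hom_mean => hyb0.
  rewrite (eq_mean (g := fun phi => (\prod_(p <- [::]) fac W phi p) *
      \prod_(p <- enum (edge_pairs H)) fac A phi p)); last first.
    by move=> phi; rewrite big_nil mul1r big_enum.
  rewrite [X in _ - X](eq_mean (g := fun phi => \prod_(p <- [::] ++ enum (edge_pairs H)) fac W phi p)); last first.
    by move=> phi; rewrite big_enum.
  by apply: hyb0 => l; rewrite mem_enum inE => /andP[].
elim: s2 s1 => [|k s2 IH] s1 us sP.
  rewrite -meanB; under eq_mean do rewrite big_nil mulr1 cats0 subrr.
  by rewrite /mean big1 ?mulr0 ?normr0 ?mul0r.
rewrite -cat_rcons in us sP *; have {}IH := IH _ us sP.
set Y := mean (fun phi => \prod_(p <- rcons s1 k ++ s2) _) in IH *.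
set X := mean _ in IH; set Z := mean _.
have -> : Z - Y = (Z - X) + (X - Y) by rewrite addrA subrK.
apply: le_trans (ler_normD _ _) _; rewrite /= -addn1 natrD mulrDl mul1r addrC lerD//.
move: us; rewrite cat_rcons cat_uniq => /and3P[_ /hasPn s12 /andP[ks2 _]].
have ks1 : k \notin s1 by apply: s12; rewrite inE eqxx.
have {}s12 : {in s2, forall l, l \notin s1} by move=> l ls; apply: s12; rewrite inE ls orbT.
pose M l := if l \in s1 then W else A.
rewrite /Z /X -meanB.
rewrite (eq_mean (g := fun phi : {ffun 'I_m -> 'I_n} => (A (phi k.1) (phi k.2) - W (phi k.1) (phi k.2)) *
    \prod_(l <- s1 ++ s2) M l (phi l.1) (phi l.2))).
  apply: (@cut_le_edge _ _ (fun i j => A i j - W i j) e k (s1 ++ s2) M) => //.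
  - by move=> l i j; rewrite /M; case: ifP.
  - by apply: sP; rewrite mem_cat mem_rcons inE eqxx.
  - move=> l ls; apply/andP; split.
      by apply: sP; move: ls; rewrite cat_rcons !mem_cat inE => /orP[]->; rewrite ?orbT.
    apply/eqP => lk; move: ls; rewrite lk mem_cat (negbTE ks1).
    by rewrite (negbTE ks2).
move=> phi; rewrite big_cat /= big_rcons/= big_cons.
rewrite (eq_big_seq (F1 := fun l => M l _ _) (fac W phi)); last first.
  by move=> l ls; rewrite /M ls.
rewrite (eq_big_seq (F1 := fun l => M l _ _) (fac A phi)); last first.
  by move=> l /s12 /negbTE ls; rewrite /M ls.
by rewrite /fac; ring.
Qed.

End counting.

(** * Weak regularity *)

Section condexp.
Variables (R : realType) (T : finType).

Section label.
Variables (D : eqType) (pi : T -> D).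

Definition fiber_card x := #|[pred y | pi y == pi x]|.

Definition cond_mean (f : T -> R) (x : T) : R :=
  (fiber_card x)%:R^-1 * \sum_(y | pi y == pi x) f y.

Lemma fiber_card_gt0 x : (0 < fiber_card x)%N.
Proof. by apply/card_gt0P; exists x; rewrite inE. Qed.

Lemma eq_cond_mean f x y : pi x = pi y -> cond_mean f x = cond_mean f y.
Proof. by move=> xy; rewrite /cond_mean /fiber_card xy. Qed.

Lemma cond_mean_unit f : unit_valued f -> unit_valued (cond_mean f).
Proof.
move=> f01 x; have N0 : 0 < (fiber_card x)%:R :> R by rewrite ltr0n fiber_card_gt0.
rewrite /cond_mean; apply/andP; split.
  by rewrite mulr_ge0 ?invr_ge0 ?ler0n// sumr_ge0// => y _; case/andP: (f01 y).
rewrite ler_pdivrMl// mulr1 /fiber_card -sum1_card natr_sum ler_sum// => y _.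
by case/andP: (f01 y).
Qed.

Lemma cond_mean_sum f (phi : T -> R) :
  (forall x y, pi x = pi y -> phi x = phi y) ->
  \sum_x cond_mean f x * phi x = \sum_x f x * phi x.
Proof.
move=> phiP; rewrite /cond_mean.
under eq_bigr do rewrite mulrAC mulr_sumr big_mkcond.
rewrite exchange_big; apply: eq_bigr => y _ /=.
rewrite -big_mkcond/= (eq_bigr (fun _ => (fiber_card y)%:R^-1 * (f y * phi y))).
  rewrite sumr_const -[_ *+ _]mulr_natl mulrA (eq_card (B := [pred x | pi x == pi y])).
    by rewrite mulfV ?mul1r// pnatr_eq0 -lt0n fiber_card_gt0.
  by move=> x; rewrite !inE eq_sym.
by move=> x /eqP xy; rewrite (phiP _ _ xy) /fiber_card xy; ring.
Qed.

End label.

(** Pythagoras: refining the partition adds to the mean square of the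
    conditional mean exactly the mean square of its change. *)
Lemma cond_mean_pythagoras (D D' : eqType) (pi : T -> D) (pi' : T -> D') f :
  (forall x y, pi' x = pi' y -> pi x = pi y) ->
  mean (fun x => cond_mean pi' f x ^+ 2) =
  mean (fun x => cond_mean pi f x ^+ 2) +
  mean (fun x => (cond_mean pi' f x - cond_mean pi f x) ^+ 2).
Proof.
move=> ref; rewrite -meanD; apply/eqP; rewrite -subr_eq0 -meanB.
rewrite (eq_mean (g := fun x => 2 * (cond_mean pi' f x * cond_mean pi f x -
    cond_mean pi f x * cond_mean pi f x))); last by move=> x; ring.
rewrite meanZ meanB /mean !cond_mean_sum; first by rewrite subrr mulr0.
  by move=> x y; exact: eq_cond_mean.
by move=> x y /ref; exact: eq_cond_mean.
Qed.

(** Cauchy-Schwarz for a test function bounded by one. *)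
Lemma sqr_mean_le (d t : T -> R) : (0 < #|T|)%N -> unit_valued t ->
  mean (fun x => d x * t x) ^+ 2 <= mean (fun x => d x ^+ 2).
Proof.
move=> T0 t01; set a := mean _.
have : 0 <= mean (fun x => (d x - a * t x) ^+ 2) by apply: mean_ge0 => x; exact: sqr_ge0.
rewrite (eq_mean (g := fun x => (d x ^+ 2 - 2 * a * (d x * t x)) + a ^+ 2 * t x ^+ 2)); last first.
  by move=> x; ring.
rewrite meanD meanB !meanZ -/a.
have : mean (fun x => t x ^+ 2) <= 1.
  rewrite -[leRHS](@mean_cst _ T)//; apply: ler_mean => x.
  by have /andP[t0 t1] := t01 x; rewrite expr_le1.
move=> /(ler_wpM2l (sqr_ge0 a)); rewrite mulr1 => h1 h2.
have -> : a ^+ 2 = 2 * a * a - a ^+ 2 by ring.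
by lra.
Qed.

End condexp.

Section regularity.
Variable R : realType.

Lemma sum_unit_le_indicator (T : finType) (h f : T -> R) : unit_valued f ->
  exists S : pred T, `|\sum_x h x * f x| <= `|\sum_x h x * (S x)%:R|.
Proof.
move=> f01; have [s0|s0] := leP 0 (\sum_x h x * f x).
  exists (fun x => 0 <= h x); rewrite ger0_norm// ger0_norm; last first.
    by apply: sumr_ge0 => x _ /=; case: (leP 0 (h x)) => hx; rewrite ?mulr1 ?mulr0.
  apply: ler_sum => x _ /=; have /andP[f0 f1] := f01 x.
  by case: (leP 0 (h x)) => [hx|/ltW hx]; rewrite ?mulr1 ?mulr0 ?ler_piMr ?mulr_le0_ge0.
exists (fun x => h x <= 0); rewrite ltr0_norm// ler0_norm; last first.
  by apply: sumr_le0 => x _ /=; case: (leP (h x) 0) => hx; rewrite ?mulr1 ?mulr0.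
rewrite lerN2; apply: ler_sum => x _ /=; have /andP[f0 f1] := f01 x.
by case: (leP (h x) 0) => [hx|/ltW hx]; rewrite ?mulr1 ?mulr0 ?mulr_ge0// ler_niMr.
Qed.

(** A bilinear form on a cube is extremal at vertices. *)
Lemma not_cut_le_indicator n (D : 'I_n -> 'I_n -> R) e : ~ cut_le D e ->
  exists S T : pred 'I_n,
    e < `|mean (fun p => D p.1 p.2 * (S p.1 && T p.2)%:R)|.
Proof.
move=> /existsNP[f /existsNP[g /not_implyP[f01 /not_implyP[g01 /negP]]]].
rewrite -ltNge => De.
have sumE (u v : 'I_n -> R) : mean (fun i => mean (fun j => D i j * (u i * v j))) =
    n%:R^-1 * (n%:R^-1 * \sum_i (\sum_j D i j * v j) * u i).
  rewrite /mean -mulr_sumr !card_ord; congr (_ * (_ * _)); apply: eq_bigr => i _.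
  by rewrite mulr_suml; apply: eq_bigr => j _; ring.
have sumE' (u v : 'I_n -> R) : mean (fun i => mean (fun j => D i j * (u i * v j))) =
    n%:R^-1 * (n%:R^-1 * \sum_j (\sum_i D i j * u i) * v j).
  rewrite mean_exchange /mean -mulr_sumr !card_ord; congr (_ * (_ * _)).
  apply: eq_bigr => j _.
  by rewrite mulr_suml; apply: eq_bigr => i _; ring.
have [S hS] := sum_unit_le_indicator (fun i => \sum_j D i j * g j) f01.
have [T hT] := sum_unit_le_indicator (fun j => \sum_i D i j * (S i)%:R) g01.
exists S, T; rewrite mean_pair /=; apply: lt_le_trans De _.
have -> : mean (fun i => mean (fun j => D i j * (S i && T j)%:R)) =
    mean (fun i => mean (fun j => D i j * ((S i)%:R * (T j)%:R))).
  by apply: eq_mean => i; apply: eq_mean => j; rewrite -natrM mulnb.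
have n1 : 0 <= n%:R^-1 :> R by rewrite invr_ge0 ler0n.
apply: (@le_trans _ _ `|mean (fun i => mean (fun j => D i j * ((S i)%:R * g j)))|).
  by rewrite !sumE !normrM (ger0_norm n1) !ler_wpM2l.
by rewrite !sumE' !normrM (ger0_norm n1) !ler_wpM2l.
Qed.

Definition block_mean (C : eqType) n (c : 'I_n -> C) (A : 'I_n -> 'I_n -> R)
    (i j : 'I_n) : R :=
  cond_mean (fun p : 'I_n * 'I_n => (c p.1, c p.2)) (fun p => A p.1 p.2) (i, j).

Definition energy (C : eqType) n (c : 'I_n -> C) (A : 'I_n -> 'I_n -> R) : R :=
  mean (fun p : 'I_n * 'I_n => block_mean c A p.1 p.2 ^+ 2).

(** If two sets witness that the block averages are far from [A], splitting
    every colour class along both sets raises the energy by a fixed amount. *)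
Lemma energy_increment n (c : 'I_n -> nat) (A : 'I_n -> 'I_n -> R) e : (0 < n)%N ->
  0 < e -> ~ cut_le (fun i j => A i j - block_mean c A i j) e ->
  exists2 c' : 'I_n -> nat,
    (forall K, (forall i, c i < K)%N -> (forall i, c' i < 4 * K)%N) &
    energy c A + e ^+ 2 <= energy c' A.
Proof.
move=> n0 e0 /not_cut_le_indicator[S [T ST]].
have n20 : (0 < #|{: 'I_n * 'I_n}|)%N by rewrite card_prod card_ord muln_gt0 n0.
(* append the two memberships as the last base-4 digit of the colour *)
pose c' i := ((c i * 2 + S i) * 2 + T i)%N.
have c'K i : [/\ c i = c' i %/ 4, S i = odd (c' i %/ 2) & T i = odd (c' i)]%N.
  by split; rewrite /c'; case: (S i); case: (T i); lia.
exists c' => [K cK i|].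
  by have := cK i; rewrite /c'; case: (S i); case: (T i); lia.
pose pi (p : 'I_n * 'I_n) := (c p.1, c p.2).
pose pi' (p : 'I_n * 'I_n) := (c' p.1, c' p.2).
have ref p q : pi' p = pi' q -> pi p = pi q.
  move=> [pq1 pq2]; rewrite /pi.
  by have [-> _ _] := c'K p.1; have [-> _ _] := c'K p.2; rewrite pq1 pq2;
     have [-> _ _] := c'K q.1; have [-> _ _] := c'K q.2.
pose Af (p : 'I_n * 'I_n) := A p.1 p.2.
have -> : energy c' A = energy c A +
    mean (fun p => (cond_mean pi' Af p - cond_mean pi Af p) ^+ 2).
  transitivity (mean (fun p => cond_mean pi' Af p ^+ 2)); first by apply: eq_mean => -[].
  by rewrite (cond_mean_pythagoras Af ref); congr (_ + _); apply: eq_mean => -[].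
rewrite lerD2l; pose t (p : 'I_n * 'I_n) : R := (S p.1 && T p.2)%:R.
have t01 : unit_valued t by move=> p; rewrite /t ler0n lern1 leq_b1.
apply: le_trans (sqr_mean_le _ n20 t01).
have <- : mean (fun p => (Af p - cond_mean pi Af p) * t p) =
    mean (fun p => (cond_mean pi' Af p - cond_mean pi Af p) * t p).
  rewrite !(eq_mean (fun p => mulrBl _ _ _)) !meanB; congr (_ - _).
  rewrite /mean cond_mean_sum// => p q [pq1 pq2]; rewrite /t.
  by have [_ -> _] := c'K p.1; have [_ _ ->] := c'K p.2; rewrite pq1 pq2;
     have [_ -> _] := c'K q.1; have [_ _ ->] := c'K q.2.
rewrite -[leRHS]real_normK ?num_real// ler_pXn2r ?nnegrE ?(ltW e0)//.
apply/ltW; rewrite (eq_mean (g := fun p => (A p.1 p.2 - block_mean c A p.1 p.2) * t p))//; by case.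
Qed.

Lemma energy_le1 (C : eqType) n (c : 'I_n -> C) (A : 'I_n -> 'I_n -> R) : (0 < n)%N ->
  (forall i j, 0 <= A i j <= 1) -> 0 <= energy c A <= 1.
Proof.
move=> n0 A01; have n20 : (0 < #|{: 'I_n * 'I_n}|)%N by rewrite card_prod card_ord muln_gt0 n0.
rewrite mean_ge0 => [/=|p]; last exact: sqr_ge0.
rewrite -[leRHS](@mean_cst _ {: 'I_n * 'I_n})//; apply: ler_mean => p.
have /andP[b0 b1] : 0 <= block_mean c A p.1 p.2 <= 1 by apply: cond_mean_unit => -[].
by rewrite expr_le1.
Qed.

(** Frieze-Kannan regularity: the energy is at most one, so energy increments
    stop after boundedly many refinements. *)
Lemma weak_regularity (e : R) : 0 < e ->
  exists K : nat, forall n (A : 'I_n -> 'I_n -> R), (0 < n)%N ->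
    (forall i j, 0 <= A i j <= 1) ->
    exists c : 'I_n -> 'I_K, cut_le (fun i j => A i j - block_mean c A i j) e.
Proof.
move=> e0; pose r := (Num.truncn (e ^- 2)).+1; exists (4 ^ r)%N => n A n0 A01.
apply: contrapT => /forallNP none.
suff [c _ cr] : exists2 c : 'I_n -> nat, (forall i, c i < 4 ^ r)%N & r%:R * e ^+ 2 <= energy c A.
  have /andP[_ /(le_trans cr)] := energy_le1 c n0 A01; apply/negP.
  rewrite -ltNge -ltr_pdivrMr ?exprn_gt0// div1r.
  exact: (real_truncnS_gt (num_real (e ^- 2))).
suff inc q : (q <= r)%N ->
    exists2 c : 'I_n -> nat, (forall i, c i < 4 ^ q)%N & q%:R * e ^+ 2 <= energy c A.
  exact: inc.
elim: q => [_|q IH qr].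
  by exists (fun _ => 0%N) => //; rewrite mul0r; case/andP: (energy_le1 (fun _ : 'I_n => 0%N) n0 A01).
have [c cq ce] := IH (ltnW qr).
have cr i : (c i < 4 ^ r)%N by rewrite (leq_trans (cq i))// leq_pexp2l// ltnW.
have nc : ~ cut_le (fun i j => A i j - block_mean c A i j) e.
  by move=> h; exact: (none (fun i => Ordinal (cr i))).
have [c' c'K ec'] := energy_increment n0 e0 nc.
exists c' => [i|]; first by rewrite expnS; exact: c'K.
by apply: le_trans ec'; rewrite -natr1 mulrDl mul1r lerD2r.
Qed.

End regularity.

(** * Graphs with independent edges *)

Section graph_sums.
Variable R : realType.

Lemma set2_ordered_inj n (p q : 'I_n * 'I_n) : (p.1 < p.2)%N -> (q.1 < q.2)%N ->
  [set p.1; p.2]%SET = [set q.1; q.2]%SET -> p = q.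
Proof.
case: p q => x y [z t] /= xy zt /setP E.
have := E x; have := E y; have := E z; have := E t; rewrite !inE !eqxx ?orbT /=.
move=> /orP[]/eqP Et /orP[]/eqP Ez /esym/orP[]/eqP Ey /esym/orP[]/eqP Ex; subst => //;
  by [rewrite ?ltnn in xy zt|move: (ltn_trans xy zt); rewrite ltnn].
Qed.

Lemma big_complete_edges (T : Type) (idx : T) (op : Monoid.com_law idx) n
    (F : {set 'I_n} -> T) :
  \big[op/idx]_(e in complete_edges n) F e =
  \big[op/idx]_(p : 'I_n * 'I_n | (p.1 < p.2)%N) F [set p.1; p.2]%SET.
Proof.
have -> : complete_edges n =
    [set [set p.1; p.2]%SET | p in [set p : 'I_n * 'I_n | (p.1 < p.2)%N]%SET]%SET.
  apply/setP => e; rewrite inE; apply/cards2P/imsetP => [[x [y [xy ->]]]|[[x y] + ->]].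
    have : (x < y)%N || (y < x)%N by rewrite -neq_ltn.
    case/orP => h; [exists (x, y)|exists (y, x)]; rewrite ?inE//=.
    by rewrite finset.setUC.
  by rewrite inE /= => xy; exists x, y; split=> //; apply: contraTneq xy => ->; rewrite ltnn.
rewrite big_imset /=; first by apply: eq_bigl => p; rewrite inE.
by move=> p q; rewrite !inE; exact: set2_ordered_inj.
Qed.

Lemma edges_sub n (G : simple_graph n) : edges G \subset complete_edges n.
Proof. by apply/fintype.subsetP => e eG; rewrite inE; have := forall_inP (valP G) _ eG. Qed.

Lemma edges_imset (H : finite_graph) :
  edges H = [set [set p.1; p.2]%SET | p in edge_pairs H]%SET.
Proof.
apply/setP => e; apply/idP/imsetP => [eH|[p + ->]]; last by rewrite inE => /andP[_].
have := fintype.subsetP (edges_sub H) _ eH; rewrite inE => /cards2P[x [y [xy exy]]].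
have : (x < y)%N || (y < x)%N by rewrite -neq_ltn.
case/orP => h; [exists (x, y)|exists (y, x)]; rewrite ?inE/= ?h//=.
- by rewrite /adj -exy.
- by rewrite /adj finset.setUC -exy.
- by rewrite finset.setUC.
Qed.

Lemma card_edge_pairs (H : finite_graph) : #|edge_pairs H| = nedges H.
Proof.
rewrite /nedges edges_imset card_in_imset// => p q; rewrite !inE => /andP[p12 _] /andP[q12 _].
exact: set2_ordered_inj.
Qed.

(** Expanding a product of sums over all pairs of vertices enumerates the
    graphs. *)
Lemma graph_sum_prod n (a b : {set 'I_n} -> R) :
  \sum_(G : simple_graph n) \prod_(e in complete_edges n) (if e \in edges G then a e else b e)
  = \prod_(e in complete_edges n) (a e + b e).
Proof.
pose F e (t : bool) := if e \in complete_edges n then if t then a e else b e else (~~ t)%:R.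
have -> : \prod_(e in complete_edges n) (a e + b e) = \prod_e \sum_t F e t.
  rewrite big_mkcond; apply: eq_bigr => e _; rewrite big_bool /F /=.
  by case: ifP => // _; rewrite add0r.
rewrite bigA_distr_bigA /= (bigID (fun f : {ffun _} => [forall e, f e ==> (e \in complete_edges n)])).
rewrite /= [X in _ = _ + X]big1 ?addr0 => [|f]; last first.
  rewrite negb_forall => /existsP[e]; rewrite negb_imply => /andP[fe eC].
  by rewrite (bigD1 e)//= /F (negbTE eC) fe mul0r.
have gP (f : {ffun {set 'I_n} -> bool}) :
    [forall e in [set e in complete_edges n | f e]%SET, #|e| == 2%N].
  by apply/forall_inP => e; rewrite !inE => /andP[].
rewrite (reindex_onto (fun G : simple_graph n => [ffun e => e \in edges G])
    (fun f => exist (fun E : {set {set 'I_n}} => [forall e in E, #|e| == 2%N] : Prop) _ (gP f)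
      : simple_graph n)) /=; last first.
  move=> f /forallP fC; apply/ffunP => e; rewrite ffunE inE.
  by have := fC e; rewrite !inE; case: (f e) => //= [->|_]; rewrite ?andbF.
rewrite [RHS](eq_bigl predT); last first.
  move=> G; rewrite /= andbC; apply/andP; split.
    apply/eqP/val_inj/setP => e; rewrite /= inE ffunE andbC /=.
    by case: (boolP (e \in edges G)) => [/(fintype.subsetP (edges_sub G))|] //=.
  apply/forallP => e; rewrite ffunE; apply/implyP.
  exact: (fintype.subsetP (edges_sub G)).
apply: eq_bigr => G _; rewrite big_mkcond; apply: eq_bigr => e _.
rewrite /F ffunE; case: ifP => // eC; case: (boolP (e \in edges G)) => // eG.
by have := fintype.subsetP (edges_sub G) _ eG; rewrite eC.
Qed.

Definition adjR n (G : simple_graph n) (i j : 'I_n) : R := (adj G i j)%:R.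

Lemma adjR01 n (G : simple_graph n) i j : 0 <= adjR G i j <= 1.
Proof. by rewrite /adjR ler0n lern1 leq_b1. Qed.

Lemma adjR_sym n (G : simple_graph n) i j : adjR G i j = adjR G j i.
Proof. by rewrite /adjR adj_sym. Qed.

(** The law of a random graph with independent edges of probabilities [W]. *)
Definition edge_law n (W : 'I_n -> 'I_n -> R) (G : simple_graph n) : R :=
  \prod_(p : 'I_n * 'I_n | (p.1 < p.2)%N)
    (if adj G p.1 p.2 then W p.1 p.2 else 1 - W p.1 p.2).

Lemma edge_law_ge0 n (W : 'I_n -> 'I_n -> R) G :
  (forall i j, 0 <= W i j <= 1) -> 0 <= edge_law W G.
Proof.
move=> W01; apply: prodr_ge0 => p _; have /andP[w0 w1] := W01 p.1 p.2.
by case: ifP; rewrite ?subr_ge0.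
Qed.

Lemma edge_law_sum1 n (W : 'I_n -> 'I_n -> R) : \sum_(G : simple_graph n) edge_law W G = 1.
Proof.
(* read [W] off the ordered pair underlying a two-element set *)
pose w (e : {set 'I_n}) := \sum_(p : 'I_n * 'I_n | (p.1 < p.2)%N && ([set p.1; p.2]%SET == e)) W p.1 p.2.
have wE (p : 'I_n * 'I_n) : (p.1 < p.2)%N -> w [set p.1; p.2]%SET = W p.1 p.2.
  move=> p12; rewrite /w (big_pred1 p)// => q /=.
  apply/idP/eqP => [/andP[q12 /eqP]|->]; first exact: set2_ordered_inj.
  by rewrite p12 eqxx.
transitivity (\sum_(G : simple_graph n) \prod_(e in complete_edges n)
    (if e \in edges G then w e else 1 - w e)).
  apply: eq_bigr => G _; rewrite big_complete_edges; apply: eq_bigr => p p12.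
  by rewrite wE.
by rewrite graph_sum_prod big1// => e _; rewrite addrC subrK.
Qed.

Lemma edge_law_cst_edges n u (F : {set {set 'I_n}}) : F \subset complete_edges n ->
  \sum_(G : simple_graph n) edge_law (fun _ _ => u) G * \prod_(e in F) (e \in edges G)%:R
  = u ^+ #|F|.
Proof.
move=> FC.
transitivity (\sum_(G : simple_graph n) \prod_(e in complete_edges n)
    (if e \in edges G then u else if e \in F then 0 else 1 - u)).
  apply: eq_bigr => G _; rewrite /edge_law.
  have := big_complete_edges *%R (fun e => if e \in edges G then u else 1 - u).
  rewrite /adj => <-; rewrite [X in _ * X](eq_bigl (fun e => (e \in complete_edges n) && (e \in F))).
    rewrite big_mkcondr -big_split; apply: eq_bigr => e _ /=.
    by case: ifP => _; case: ifP; rewrite ?mulr1 ?mulr0.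
  by move=> e; case: (boolP (e \in F)) => [/(fintype.subsetP FC) ->|]; rewrite ?andbF.
rewrite graph_sum_prod (eq_bigr (fun e => if e \in F then u else 1)); last first.
  by move=> e _; case: ifP; rewrite ?addr0// addrC subrK.
rewrite -big_mkcondr (eq_bigl (mem F)) ?prodr_const// => e /=.
by case: (boolP (e \in F)) => [/(fintype.subsetP FC) ->|]; rewrite ?andbF.
Qed.

End graph_sums.

Section entropy_bound.
Variable R : realType.

Lemma sum_pairs_sym n (g : 'I_n * 'I_n -> R) : (forall i j, g (i, j) = g (j, i)) ->
  \sum_p g p = 2 * (\sum_(p : 'I_n * 'I_n | (p.1 < p.2)%N) g p) + \sum_i g (i, i).
Proof.
move=> gs; rewrite (bigID (fun p : 'I_n * 'I_n => (p.1 < p.2)%N)) /=.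
rewrite [X in _ + X](bigID (fun p : 'I_n * 'I_n => (p.2 < p.1)%N)) /=.
rewrite addrA mulr2n mulrDl !mul1r; congr (_ + _ + _).
  rewrite (reindex_inj (h := fun p : 'I_n * 'I_n => (p.2, p.1))) /=.
    by apply: eq_big => -[i j] //=; case: ltngtP.
  by move=> [i j] [k l] [-> ->].
rewrite (reindex_onto (fun i => (i, i)) (fun p : 'I_n * 'I_n => p.1)) /=.
  by apply: eq_bigl => i; rewrite eqxx ltnn.
by move=> [i j] /=; case: ltngtP => // /val_inj ->.
Qed.

Lemma block_mean_sym (C : eqType) n (c : 'I_n -> C) (A : 'I_n -> 'I_n -> R) i j :
  (forall i j, A i j = A j i) -> block_mean c A i j = block_mean c A j i.
Proof.
move=> As; rewrite /block_mean /cond_mean /fiber_card; congr (_%:R^-1 * _).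
  rewrite -!sum1_card (reindex_inj (h := fun p : 'I_n * 'I_n => (p.2, p.1))) /=.
    by apply: eq_bigl => -[k l]; rewrite !inE /= !xpair_eqE andbC.
  by move=> [? ?] [? ?] [-> ->].
rewrite (reindex_inj (h := fun p : 'I_n * 'I_n => (p.2, p.1))) /=.
  by apply: eq_big => -[k l] /=; [rewrite !xpair_eqE andbC|move=> _; exact: As].
by move=> [? ?] [? ?] [-> ->].
Qed.

(** A graph has at least the entropic probability under the law whose edge
    probabilities are its own block averages: the log-likelihood is linear in
    the adjacency matrix with blockwise constant coefficients, so the matrix
    may be replaced by its block averages. *)
Lemma expR_rate_le_edge_law (C : eqType) n (c : 'I_n -> C) (G : simple_graph n) :
  expR (\sum_p rate (block_mean c (@adjR R n G) p.1 p.2)) <=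
  edge_law (block_mean c (@adjR R n G)) G.
Proof.
set W := block_mean c _; pose A := @adjR R n G.
have W01 i j : 0 <= W i j <= 1 by apply: cond_mean_unit => p; exact: adjR01.
pose pi (p : 'I_n * 'I_n) := (c p.1, c p.2).
pose N p : R := (fiber_card pi p)%:R.
have N0 p : 0 < N p by rewrite ltr0n fiber_card_gt0.
have Wpos p : adj G p.1 p.2 -> 0 < W p.1 p.2.
  case: p => i j /= Gij; rewrite /W /block_mean /cond_mean -/pi.
  apply: mulr_gt0; first by rewrite invr_gt0; exact: N0.
  rewrite (bigD1 (i, j))//= ltr_pwDl//; first by rewrite /adjR Gij.
  by apply: sumr_ge0 => q _; case/andP: (adjR01 R G q.1 q.2).
have Wlt1 p : ~~ adj G p.1 p.2 -> 0 < 1 - W p.1 p.2.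
  case: p => i j /= Gij; rewrite subr_gt0 /W /block_mean /cond_mean -/pi.
  rewrite ltr_pdivrMl ?N0// mulr1 /fiber_card -sum1_card natr_sum.
  rewrite (bigD1 (i, j))//= [ltRHS](bigD1 (i, j)) ?inE//= /adjR (negbTE Gij).
  apply: ltr_leD => //; apply: ler_sum => q _; case/andP: (adjR01 R G q.1 q.2) => _.
  exact.
pose g p : R := A p.1 p.2 * ln (W p.1 p.2) + (1 - A p.1 p.2) * ln (1 - W p.1 p.2).
have -> : edge_law W G = expR (\sum_(p : 'I_n * 'I_n | (p.1 < p.2)%N) g p).
  rewrite expR_sum; apply: eq_bigr => p _; rewrite /g /A /adjR.
  case: ifPn => Gp; rewrite ?mul1r ?subrr ?subr0 ?mul0r ?addr0 ?add0r ?mul1r lnK// posrE.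
    exact: Wpos.
  exact: Wlt1.
rewrite ler_expR.
have gs i j : g (i, j) = g (j, i).
  by rewrite /g /= /W (block_mean_sym c i j (adjR_sym R G)) /A (adjR_sym R G i j).
(* the diagonal of the block averages, absent from the law, helps *)
have gd : \sum_i g (i, i) <= 0.
  apply: sumr_le0 => i _; rewrite /g /A /adjR /= adj_irr mul0r add0r subr0 mul1r.
  by apply: ln_le0; rewrite gerBl; case/andP: (W01 i i).
have := sum_pairs_sym gs.
suff -> : \sum_p g p = 2 * \sum_p rate (W p.1 p.2) by lra.
pose L1 (p : 'I_n * 'I_n) : R := ln (W p.1 p.2).
pose L2 (p : 'I_n * 'I_n) : R := ln (1 - W p.1 p.2).
have WC (p q : 'I_n * 'I_n) : pi p = pi q -> W p.1 p.2 = W q.1 q.2.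
  by case: p q => i j [k l]; exact: eq_cond_mean.
transitivity (\sum_p (A p.1 p.2 * (L1 p - L2 p) + L2 p)).
  by apply: eq_bigr => p _; rewrite /g /L1 /L2; ring.
rewrite big_split /= -(@cond_mean_sum _ _ _ pi); last first.
  by move=> p q /WC; rewrite /L1 /L2 => ->.
rewrite -big_split /= mulr_sumr; apply: eq_bigr => -[i j] _.
rewrite -[cond_mean _ _ _]/(W i j) /L1 /L2 /rate /=; by field.
Qed.

End entropy_bound.

(** * Lower bound on the partition function *)

Section lower_bound.
Variable R : realType.

Lemma unit_dist_le1 (a b : R) : 0 <= a <= 1 -> 0 <= b <= 1 -> `|a - b| <= 1.
Proof. by move=> /andP[a0 a1] /andP[b0 b1]; rewrite ler_norml; lra. Qed.

Lemma edge_law_cst_adj n u (p : 'I_n * 'I_n) : (p.1 < p.2)%N ->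
  \sum_(G : simple_graph n) edge_law (fun _ _ => u) G * (adj G p.1 p.2)%:R = u :> R.
Proof.
move=> p12; have := @edge_law_cst_edges R n u [set [set p.1; p.2]%SET]%SET.
rewrite cards1 expr1 => h; rewrite -[RHS]h.
  by apply: eq_bigr => G _; rewrite big_set1.
have p12' : p.1 != p.2 by apply: contraTneq p12 => ->; rewrite ltnn.
by rewrite finset.sub1set inE cards2 p12'.
Qed.

Lemma edge_law_cst_hom (m n : nat) (S : {set 'I_m * 'I_m}) (phi : 'I_m -> 'I_n) u :
  injective phi -> {in S, forall p : 'I_m * 'I_m, (p.1 < p.2)%N} ->
  \sum_(G : simple_graph n) edge_law (fun _ _ => u) G *
     \prod_(p in S) adjR R G (phi p.1) (phi p.2) = u ^+ #|S|.
Proof.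
move=> phi_inj SP; pose im (p : 'I_m * 'I_m) := [set phi p.1; phi p.2]%SET.
have imE (p : 'I_m * 'I_m) : im p = (phi @: [set p.1; p.2])%SET.
  by rewrite /im finset.imsetU !imset_set1.
have im_inj : {in S &, injective im}.
  move=> p q pS qS; rewrite !imE => /(imset_inj phi_inj).
  by apply: set2_ordered_inj; exact: SP.
rewrite -(card_in_imset im_inj) -(@edge_law_cst_edges R n).
  by apply: eq_bigr => G _; rewrite big_imset.
apply/fintype.subsetP => _ /imsetP[p pS ->]; rewrite inE cards2 (inj_eq phi_inj).
suff -> : p.1 != p.2 by [].
by apply: contraTneq (SP _ pS) => ->; rewrite ltnn.
Qed.

(** Union bound over the pairs of vertices that may collide. *)
Lemma mean_not_injective (m n : nat) : (0 < n)%N ->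
  mean (fun phi : {ffun 'I_m -> 'I_n} => (~~ injectiveb phi)%:R) <=
  (m ^ 2)%N%:R / n%:R :> R.
Proof.
move=> n0; have In0 : (0 < #|'I_n|)%N by rewrite card_ord.
apply: (@le_trans _ _ (mean (fun phi : {ffun 'I_m -> 'I_n} =>
    \sum_(p : 'I_m * 'I_m) ((p.1 != p.2) && (phi p.1 == phi p.2))%:R))).
  apply: ler_mean => phi; case: (boolP (injectiveb phi)) => [_|/injectivePn[a [b ab Eab]]].
    by rewrite sumr_ge0.
  rewrite (bigD1 (a, b))//= ab Eab eqxx lerDl sumr_ge0//.
rewrite mean_sum (@le_trans _ _ (\sum_(p : 'I_m * 'I_m) n%:R^-1))//; last first.
  by rewrite sumr_const card_prod card_ord -mulnn -[_ *+ _]mulr_natl.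
apply: ler_sum => -[a b] _ /=; have [ab|ab] /= := eqVneq a b.
  by rewrite /mean big1 ?mulr0 ?invr_ge0.
rewrite (mean_marginal2 (fun x y => (x == y)%:R))//.
rewrite (eq_mean (g := fun _ => n%:R^-1)) ?mean_cst// => x.
rewrite /mean card_ord (bigD1 x)//= eqxx big1 ?addr0 ?mulr1// => y.
by rewrite eq_sym => /negbTE ->.
Qed.

(** Independent edges of probability [u] give the density [u ^+ nedges H] up
    to the maps that are not injective, a fraction [O(1/n)] of all maps. *)
Lemma edge_law_cst_hom_mean (H : finite_graph) n u : (0 < n)%N -> 0 <= u <= 1 ->
  `|\sum_(G : simple_graph n) edge_law (fun _ _ => u) G * hom_mean H (adjR R G)
     - u ^+ nedges H| <= (nvertices H ^ 2)%N%:R / n%:R.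
Proof.
move=> n0 u01; set m := nvertices H; pose q := @edge_law R n (fun _ _ => u).
have q0 G : 0 <= q G by apply: edge_law_ge0.
have F0 : (0 < #|{ffun 'I_m -> 'I_n}|)%N by rewrite card_ffun !card_ord expn_gt0 n0.
pose t (phi : {ffun 'I_m -> 'I_n}) G : R :=
  \prod_(p in edge_pairs H) adjR R G (phi p.1) (phi p.2).
have t01 phi G : 0 <= t phi G <= 1 by apply: prod_unit => p; exact: adjR01.
have -> : \sum_G q G * hom_mean H (adjR R G) = mean (fun phi => \sum_G q G * t phi G).
  by rewrite mean_sum; apply: eq_bigr => G _; rewrite meanZ.
rewrite -[u ^+ _](@mean_cst R _ (u ^+ nedges H) F0) -meanB.
apply: le_trans (ler_norm_mean _) _; apply: le_trans (mean_not_injective m n0).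
apply: ler_mean => phi; case: (boolP (injectiveb phi)) => [/injectiveP phi_inj|_] /=.
  rewrite edge_law_cst_hom ?card_edge_pairs ?subrr ?normr0// => p.
  by rewrite inE => /andP[].
have /andP[u0 u1] : 0 <= u ^+ nedges H <= 1 by case/andP: u01 => ? ?; rewrite exprn_ge0// exprn_ile1.
have s0 : 0 <= \sum_G q G * t phi G.
  by apply: sumr_ge0 => G _; rewrite mulr_ge0//; case/andP: (t01 phi G).
have s1 : \sum_G q G * t phi G <= 1.
  rewrite -(@edge_law_sum1 R n (fun _ _ => u)); apply: ler_sum => G _.
  by rewrite ler_piMr//; case/andP: (t01 phi G).
by apply: unit_dist_le1; apply/andP.
Qed.

(** Jensen's inequality for the exponential, by its tangent at the mean. *)
Lemma expR_wsum_le (T : finType) (q X : T -> R) : (forall x, 0 <= q x) ->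
  \sum_x q x = 1 -> expR (\sum_x q x * X x) <= \sum_x q x * expR (X x).
Proof.
move=> q0 q1; set a := \sum_x q x * X x.
have -> : expR a = \sum_x q x * (expR a * (1 + (X x - a))).
  under eq_bigr do rewrite mulrCA mulrDr mulr1 mulrBr.
  by rewrite -mulr_sumr big_split /= sumrB -mulr_suml q1 mul1r -/a subrr addr0 mulr1.
apply: ler_sum => x _; rewrite ler_wpM2l//.
rewrite -[X in _ <= expR X](subrKC a) expRD ler_wpM2l ?expR_ge0//; exact: expR_ge1Dx.
Qed.

(** Gibbs variational lower bound with a constant edge density.  Degenerate
    densities are covered because [expR (ln 0)] is still at least [0]. *)
Lemma partition_function_ge k (H : 'I_k -> finite_graph) (beta : 'I_k -> R) u :
  0 <= u <= 1 -> exists C : R, forall n, (0 < n)%N ->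
  expR (n%:R ^+ 2 * scalar_objective H beta u - C * n%:R) <=
  \sum_(G : simple_graph n)
    expR (n%:R ^+ 2 * \sum_(i < k) beta i * hom_mean (H i) (adjR R G)).
Proof.
move=> u01; have /andP[u0 u1] := u01.
exists (\sum_(i < k) `|beta i| * (nvertices (H i) ^ 2)%N%:R + `|rate u|) => n n0.
pose q := @edge_law R n (fun _ _ => u).
pose T (G : simple_graph n) : R := \sum_(i < k) beta i * hom_mean (H i) (adjR R G).
pose Y (G : simple_graph n) : R := \sum_(p : 'I_n * 'I_n | (p.1 < p.2)%N)
  (if adj G p.1 p.2 then ln u else ln (1 - u)).
have q0 G : 0 <= q G by apply: edge_law_ge0.
have q1 : \sum_G q G = 1 by exact: edge_law_sum1.
have lnP x : 0 <= x -> x <= expR (ln x) :> R.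
  rewrite le_eqVlt => /predU1P[<-|x0]; first exact: expR_ge0.
  by rewrite lnK// posrE.
(* only an inequality, as [u] may be [0] or [1] *)
have qY G : q G <= expR (Y G).
  rewrite /Y expR_sum; apply: ler_prod => p _.
  by case: ifP => _ /=; rewrite lnP ?subr_ge0 // andbT ?subr_ge0.
apply: (@le_trans _ _ (\sum_G q G * expR (n%:R ^+ 2 * T G - Y G))); last first.
  apply: ler_sum => G _; rewrite expRB mulrCA ler_piMr ?expR_ge0//.
  by rewrite ler_pdivrMr ?expR_gt0// mul1r.
apply: le_trans (expR_wsum_le _ q0 q1); rewrite ler_expR.
have -> : \sum_G q G * (n%:R ^+ 2 * T G - Y G) =
    n%:R ^+ 2 * (\sum_G q G * T G) - \sum_G q G * Y G.
  by rewrite mulr_sumr -sumrB; apply: eq_bigr => G _; ring.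
have qYE : \sum_G q G * Y G = (n%:R ^+ 2 - n%:R) * rate u.
  transitivity (\sum_(p : 'I_n * 'I_n | (p.1 < p.2)%N) 2 * rate u).
    under eq_bigr do rewrite mulr_sumr.
    rewrite exchange_big; apply: eq_bigr => p p12 /=.
    have <- : u * ln u + (1 - u) * ln (1 - u) = 2 * rate u by rewrite /rate; field.
    transitivity (\sum_G ((ln u - ln (1 - u)) * (q G * (adj G p.1 p.2)%:R)
        + ln (1 - u) * q G)).
      by apply: eq_bigr => G _; case: (adj G p.1 p.2) => /=; ring.
    rewrite big_split /= -!mulr_sumr q1 (edge_law_cst_adj u p12); ring.
  have := @sum_pairs_sym R n (fun _ => 2 * rate u) (fun _ _ => erefl).
  set S := \sum_(p : 'I_n * 'I_n | (p.1 < p.2)%N) _.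
  rewrite !sumr_const card_prod !card_ord.
  rewrite -[_ *+ (n * n)%N]mulr_natl -[_ *+ n]mulr_natl natrM.
  by move: (rate u) S => ? S ?; lra.
have TE : scalar_objective H beta u + rate u - (\sum_(i < k) `|beta i| * (nvertices (H i) ^ 2)%N%:R) / n%:R
    <= \sum_G q G * T G.
  have -> : \sum_G q G * T G =
      \sum_(i < k) beta i * \sum_G q G * hom_mean (H i) (adjR R G).
    under eq_bigr do rewrite mulr_sumr.
    rewrite exchange_big; apply: eq_bigr => i _ /=; rewrite mulr_sumr.
    by apply: eq_bigr => G _; rewrite mulrCA.
  rewrite /scalar_objective subrK mulr_suml -sumrB; apply: ler_sum => i _.
  rewrite lerBlDr -lerBlDl -mulrBr -mulrA.
  apply: le_trans (ler_norm _) _; rewrite normrM ler_wpM2l// distrC.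
  exact: edge_law_cst_hom_mean.
have n1 : 0 < n%:R :> R by rewrite ltr0n.
have := ler_wpM2l (sqr_ge0 (n%:R : R)) TE.
set C := \sum_(i < k) `|beta i| * _; set S := \sum_G q G * T G => h.
have -> : n%:R ^+ 2 * scalar_objective H beta u - (C + `|rate u|) * n%:R =
  n%:R ^+ 2 * (scalar_objective H beta u + rate u - C / n%:R) - n%:R ^+ 2 * rate u - `|rate u| * n%:R.
  by field; rewrite gt_eqF.
rewrite qYE; have := ler_norm (- rate u); rewrite normrN => /(ler_wpM2r (ltW n1)); lra.
Qed.

End lower_bound.

(** * The arithmetic-geometric inequality with deficit *)

Section amgm.
Variable R : realType.

Lemma prod_le_mean_power (I : finType) (S : {set I}) (a : I -> R) :
  (0 < #|S|)%N -> (forall i, 0 <= a i) ->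
  \prod_(i in S) a i <= #|S|%:R^-1 * \sum_(i in S) a i ^+ #|S|.
Proof.
move=> S0 a0.
have p0 : 0 <= \prod_(i in S) a i by exact: prodr_ge0.
have s0 : 0 <= #|S|%:R^-1 * \sum_(i in S) a i ^+ #|S|.
  by rewrite mulr_ge0 ?invr_ge0 ?sumr_ge0// => i _; rewrite exprn_ge0.
rewrite -(ler_pXn2r S0) ?nnegrE// -prodrXl mulrC.
have a0' : {in mem S, forall i, 0 <= a i ^+ #|S|} by move=> i _ /=; rewrite exprn_ge0.
by have [] := leif_AGM a0'.
Qed.

Lemma subX_superadditive (x y : R) m : (0 < m)%N -> 0 <= y -> y <= x ->
  (x - y) ^+ m <= x ^+ m - y ^+ m.
Proof.
move=> m0 y0 yx; have d0 : 0 <= x - y by rewrite subr_ge0.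
rewrite lerBrDr; have := subrK y x; move: (x - y) d0 => d d0 <-.
elim: m m0 => // -[|m] IH _; first by rewrite !expr1.
rewrite exprS [leRHS]exprS; apply: (@le_trans _ _ ((d + y) * (d ^+ m.+1 + y ^+ m.+1))).
  rewrite [y ^+ _]exprS mulrDl !mulrDr lerD//; first by rewrite lerDl mulr_ge0 ?exprn_ge0.
  by rewrite lerDr mulr_ge0 ?exprn_ge0.
by rewrite ler_wpM2l ?addr_ge0// IH.
Qed.

(** Replacing two factors by their geometric mean keeps the product and lowers
    the power sum by the square of the difference of the half powers. *)
Lemma prod_le_mean_power_deficit (I : finType) (S : {set I}) (a : I -> R) k l :
  k \in S -> l \in S -> k != l -> unit_valued a ->
  \prod_(i in S) a i <= #|S|%:R^-1 * \sum_(i in S) a i ^+ #|S|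
    - #|S|%:R^-1 * (`|a k - a l| / 2) ^+ (2 * #|S|).
Proof.
wlog alk : k l / a l <= a k.
  move=> h kS lS kl a01; have [alk|/ltW akl] := leP (a l) (a k); first exact: h.
  by rewrite distrC; apply: h => //; rewrite eq_sym.
move=> kS lS kl a01; set m := #|S|.
have m0 : (0 < m)%N by apply/card_gt0P; exists k.
have a0 i : 0 <= a i by case/andP: (a01 i).
pose x := Num.sqrt (a k); pose y := Num.sqrt (a l).
have xE : x ^+ 2 = a k by rewrite sqr_sqrtr.
have yE : y ^+ 2 = a l by rewrite sqr_sqrtr.
have y0 : 0 <= y by exact: sqrtr_ge0.
have yx : y <= x by rewrite ler_sqrt.
have x0 : 0 <= x by exact: sqrtr_ge0.
have x1 : x <= 1.
  by rewrite -(@ler_pXn2r _ 2) ?nnegrE// expr1n xE; case/andP: (a01 k).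
pose b i := if (i == k) || (i == l) then x * y else a i.
have b0 i : 0 <= b i by rewrite /b; case: ifP => _; rewrite ?mulr_ge0.
have bk : b k = x * y by rewrite /b eqxx.
have bl : b l = x * y by rewrite /b eqxx orbT.
have ba i : (i != k) && (i != l) -> b i = a i by rewrite /b -negb_or => /negbTE ->.
have lk : (l \in S) && (l != k) by rewrite lS eq_sym.
have -> : \prod_(i in S) a i = \prod_(i in S) b i.
  rewrite (bigD1 k)//= (bigD1 l)//= [RHS](bigD1 k)//= [in RHS](bigD1 l)//=.
  rewrite bk bl !mulrA -xE -yE; congr (_ * _); first by ring.
  by apply: eq_bigr => i /andP[/andP[_ ik] il]; rewrite ba ?ik.
apply: le_trans (prod_le_mean_power m0 b0) _; rewrite -mulrBr ler_wpM2l ?invr_ge0// -/m.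
rewrite (bigD1 k)//= (bigD1 l)//= [in leRHS](bigD1 k)//= [in leRHS](bigD1 l)//=.
rewrite (eq_bigr (fun i => a i ^+ m)) => [|i /andP[/andP[_ ik] il]]; last by rewrite ba ?ik.
set r := \sum_(i | (i \in S) && (i != k) && (i != l)) _; rewrite bk bl.
suff : (`|a k - a l| / 2) ^+ (2 * m) <= (x ^+ m - y ^+ m) ^+ 2.
  have -> : a k ^+ m = (x ^+ m) ^+ 2 by rewrite -xE exprAC.
  have -> : a l ^+ m = (y ^+ m) ^+ 2 by rewrite -yE exprAC.
  by rewrite [(x * y) ^+ m]exprMn; move: (x ^+ m) (y ^+ m) ((_ / _) ^+ (2 * m)) => X Y D; lra.
rewrite mulnC exprM ler_pXn2r ?nnegrE ?exprn_ge0 ?divr_ge0//; last first.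
  by rewrite subr_ge0 ler_pXn2r.
apply: le_trans (subX_superadditive m0 y0 yx).
rewrite ler_pXn2r ?nnegrE ?divr_ge0 ?subr_ge0// ger0_norm ?subr_ge0//.
by rewrite ler_pdivrMr// -xE -yE subr_sqr ler_wpM2l ?subr_ge0//; lra.
Qed.

End amgm.

(** * Near-maximizers of the mean-field functional *)

Section stability.
Variable R : realType.

Lemma mean_marginal1 (I T : finType) (a : I) (g : T -> R) : (0 < #|T|)%N ->
  mean (fun phi : {ffun I -> T} => g (phi a)) = mean g.
Proof.
move=> T0; rewrite (mean_resample a)//.
rewrite (eq_mean (g := fun _ => mean g)) ?mean_cst ?card_ffun ?expn_gt0 ?T0// => phi.
by apply: eq_mean => x; rewrite updE eqxx.
Qed.

Lemma mean_fun_pair (S T : finType) (f : S -> T -> R) :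
  mean (fun p : S * T => f p.1 p.2) = mean (fun x => mean (f x)).
Proof. by rewrite mean_pair. Qed.

Lemma mean_edge_pair (m n : nat) (p : 'I_m * 'I_m)
    (g : 'I_n -> 'I_n -> R) : (0 < n)%N -> (p.1 < p.2)%N ->
  mean (fun phi : {ffun 'I_m -> 'I_n} => g (phi p.1) (phi p.2)) =
  mean (fun q => g q.1 q.2).
Proof.
move=> n0 p12; rewrite mean_fun_pair mean_marginal2 ?card_ord//.
by apply: contraTneq p12 => ->; rewrite ltnn.
Qed.

Lemma edge_pairs_lt (H : finite_graph) p : p \in edge_pairs H -> (p.1 < p.2)%N.
Proof. by rewrite inE => /andP[]. Qed.

Lemma mean_powers_edges (H : finite_graph) n (W : 'I_n -> 'I_n -> R) m :
  (0 < n)%N -> (0 < nedges H)%N ->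
  mean (fun phi : {ffun 'I_(nvertices H) -> 'I_n} =>
    (nedges H)%:R^-1 * \sum_(p in edge_pairs H) W (phi p.1) (phi p.2) ^+ m) =
  mean (fun q => W q.1 q.2 ^+ m).
Proof.
move=> n0 H0; rewrite meanZ.
rewrite (eq_mean (g := fun phi : {ffun 'I_(nvertices H) -> 'I_n} =>
  \sum_p (if p \in edge_pairs H then W (phi p.1) (phi p.2) ^+ m else 0))); last first.
  by move=> phi; rewrite big_mkcond.
rewrite mean_sum -[X in _ * X]/(\sum_(p : 'I_(nvertices H) * 'I_(nvertices H))
  mean (fun phi : {ffun 'I_(nvertices H) -> 'I_n} =>
    if p \in edge_pairs H then W (phi p.1) (phi p.2) ^+ m else 0)).
rewrite (bigID (mem (edge_pairs H))) /= [X in _ + X]big1 ?addr0; last first.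
  by move=> p /negbTE ->; rewrite /mean big1 ?mulr0.
rewrite (eq_bigr (fun _ => mean (fun q => W q.1 q.2 ^+ m))) => [|p pH].
  rewrite sumr_const card_edge_pairs -[X in _ * X]mulr_natl mulrA mulVf ?mul1r//.
  by rewrite pnatr_eq0 -lt0n.
rewrite pH (@mean_edge_pair _ _ p (fun x y => W x y ^+ m))//.
exact: edge_pairs_lt.
Qed.

Lemma hom_mean_edge (H : finite_graph) n (W : 'I_n -> 'I_n -> R) : (0 < n)%N ->
  nedges H = 1%N -> hom_mean H W = mean (fun q => W q.1 q.2).
Proof.
move=> n0 H1; transitivity (mean (fun q => W q.1 q.2 ^+ 1)); last by [].
rewrite -(mean_powers_edges (H := H) W 1 n0) ?H1//.
have /eqP/cards1P[p Ep] : #|edge_pairs H| = 1%N by rewrite card_edge_pairs.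
by apply: eq_mean => phi; rewrite Ep !big_set1 invr1 mul1r expr1.
Qed.

(** AM-GM edge by edge replaces the generalized Hoelder inequality. *)
Lemma hom_mean_le_power (H : finite_graph) n (W : 'I_n -> 'I_n -> R) : (0 < n)%N ->
  (0 < nedges H)%N -> (forall i j, 0 <= W i j <= 1) ->
  hom_mean H W <= mean (fun q => W q.1 q.2 ^+ nedges H).
Proof.
move=> n0 H0 W01; rewrite -(mean_powers_edges W (nedges H) n0 H0).
apply: ler_mean => phi; rewrite -card_edge_pairs.
apply: (@prod_le_mean_power _ _ _ (fun p => W (phi p.1) (phi p.2))).
  by rewrite card_edge_pairs.
by move=> p; case/andP: (W01 (phi p.1) (phi p.2)).
Qed.

Lemma hom_mean_le_power_deficit (H : finite_graph) n (W : 'I_n -> 'I_n -> R) k l :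
  (0 < n)%N -> (forall i j, 0 <= W i j <= 1) ->
  k \in edge_pairs H -> l \in edge_pairs H -> k != l ->
  hom_mean H W <= mean (fun q => W q.1 q.2 ^+ nedges H) -
    (nedges H)%:R^-1 * mean (fun phi : {ffun 'I_(nvertices H) -> 'I_n} =>
      (`|W (phi k.1) (phi k.2) - W (phi l.1) (phi l.2)| / 2) ^+ (2 * nedges H)).
Proof.
move=> n0 W01 kH lH kl.
have H0 : (0 < nedges H)%N by rewrite -card_edge_pairs; apply/card_gt0P; exists k.
rewrite -(mean_powers_edges W (nedges H) n0 H0) -meanZ -meanB.
apply: ler_mean => phi; rewrite -card_edge_pairs.
apply: (@prod_le_mean_power_deficit _ _ _ (fun p => W (phi p.1) (phi p.2)) k l) => //.
Qed.

(** Disjoint edges are sent to independent pairs.  If the edges share a vertex,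
    a pair adjacent to both of two independent pairs links them in two steps. *)
Lemma two_edges_oriented (m n : nat) (W : 'I_n -> 'I_n -> R) (a b c d : 'I_m) :
  (0 < n)%N -> (forall i j, W i j = W j i) ->
  b != a -> b != c -> b != d -> d != a -> d != c ->
  mean (fun q => mean (fun p => `|W p.1 p.2 - W q.1 q.2|)) <=
  2 * mean (fun phi : {ffun 'I_m -> 'I_n} =>
        `|W (phi a) (phi b) - W (phi c) (phi d)|).
Proof.
move=> n0 Ws ba bc bd da dc; have In0 : (0 < #|'I_n|)%N by rewrite card_ord.
have -> : mean (fun phi : {ffun 'I_m -> 'I_n} =>
    `|W (phi a) (phi b) - W (phi c) (phi d)|) =
  mean (fun phi : {ffun 'I_m -> 'I_n} =>
    mean (fun t => mean (fun y => `|W (phi a) y - W (phi c) t|))).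
  rewrite (mean_resample b)// (mean_resample d)//.
  apply: eq_mean => phi; apply: eq_mean => t; apply: eq_mean => y.
  rewrite !updE !eqxx [d == b]eq_sym [a == b]eq_sym [c == b]eq_sym [a == d]eq_sym [c == d]eq_sym.
  by rewrite (negbTE ba) (negbTE bc) (negbTE bd) (negbTE da) (negbTE dc).
pose g x z := mean (fun t => mean (fun y => `|W x y - W z t|)).
have LE : mean (fun q => mean (fun p => `|W p.1 p.2 - W q.1 q.2|)) = mean (fun x => mean (g x)).
  rewrite (eq_mean (g := fun q => mean (fun x => mean (fun y => `|W x y - W q.1 q.2|)))); last first.
    by move=> q; rewrite -mean_fun_pair.
  rewrite (mean_fun_pair (fun z t => mean (fun x => mean (fun y => `|W x y - W z t|)))).
  rewrite [RHS]mean_exchange; apply: eq_mean => z; rewrite mean_exchange.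
  by [].
rewrite LE; have [ac|ac] := eqVneq a c; last first.
  rewrite (mean_marginal2 g In0 ac) ler_peMl ?ler1n//.
  by do 4!(apply: mean_ge0 => ?).
rewrite -ac (mean_marginal1 a (fun x => g x x) In0).
pose h x y t := `|W x y - W x t|.
have gE : mean (fun x => g x x) = mean (fun x => mean (fun t => mean (fun y => h x y t))) by [].
(* the walk from W x y through W x t = W t x to W t z = W z t *)
have tri x z t y : `|W x y - W z t| <= h x y t + h t x z.
  by rewrite /h (Ws t x) (Ws t z); apply: ler_distD.
apply: (@le_trans _ _ (mean (fun x => mean (fun z => mean (fun t => mean (fun y =>
    h x y t + h t x z)))))).
  by do 4!(apply: ler_mean => ?); exact: tri.
under eq_mean do under eq_mean do under eq_mean do rewrite meanD (mean_cst _ In0).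
under eq_mean do under eq_mean do rewrite meanD.
under eq_mean do rewrite meanD (mean_cst _ In0).
rewrite meanD -gE mulr2n mulrDl mul1r lerD2l gE.
under eq_mean do rewrite mean_exchange.
rewrite mean_exchange; apply: ler_mean => t.
by rewrite [leRHS]mean_exchange.
Qed.

(** Each of two distinct edges has an end outside the other one. *)
Lemma two_edges (H : finite_graph) n (W : 'I_n -> 'I_n -> R) k l :
  (0 < n)%N -> (forall i j, W i j = W j i) ->
  k \in edge_pairs H -> l \in edge_pairs H -> k != l ->
  mean (fun q => mean (fun p => `|W p.1 p.2 - W q.1 q.2|)) <=
  2 * mean (fun phi : {ffun 'I_(nvertices H) -> 'I_n} =>
        `|W (phi k.1) (phi k.2) - W (phi l.1) (phi l.2)|).
Proof.
move=> n0 Ws /edge_pairs_lt + /edge_pairs_lt; case: k l => k1 k2 [l1 l2] /= k12 l12 kl.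
pose m1 (a b c d : 'I_(nvertices H)) := mean (fun phi : {ffun 'I_(nvertices H) -> 'I_n} =>
        `|W (phi a) (phi b) - W (phi c) (phi d)|).
have sw1 a b c d : m1 a b c d = m1 b a c d by apply: eq_mean => phi; rewrite Ws.
have sw2 a b c d : m1 a b c d = m1 a b d c by apply: eq_mean => phi; rewrite (Ws (phi c)).
rewrite -/(m1 k1 k2 l1 l2).
have vneq (i j : 'I_(nvertices H)) : (i != j) = (i != j :> nat) by [].
have [k2l2|k2l2] := eqVneq k2 l2.
  have k1l1 : k1 != l1 by apply: contraNneq kl => ->; rewrite k2l2.
  rewrite vneq in k1l1; move/(congr1 val): k2l2 => /= k2l2.
  by rewrite sw1 sw2; apply: two_edges_oriented => //; rewrite vneq; lia.
rewrite vneq in k2l2; have [k2l1|k2l1] := eqVneq k2 l1.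
  move/(congr1 val): k2l1 => /= k2l1.
  by rewrite sw1; apply: two_edges_oriented => //; rewrite vneq; lia.
rewrite vneq in k2l1; have [l2k1|l2k1] := eqVneq l2 k1.
  move/(congr1 val): l2k1 => /= l2k1.
  by rewrite sw2; apply: two_edges_oriented => //; rewrite vneq; lia.
rewrite vneq in l2k1.
by apply: two_edges_oriented => //; rewrite vneq; lia.
Qed.

(** Jensen's inequality in a weak form: values below [e] contribute at most
    [e], and above [e] the rescaled power dominates. *)
Lemma mean_norm_le_power (T : finType) (f : T -> R) (e : R) m : (0 < #|T|)%N ->
  (0 < m)%N -> 0 < e -> (forall x, 0 <= f x <= 1) ->
  mean f <= e + (2 / e) ^+ m * mean (fun x => (f x / 2) ^+ m).
Proof.
move=> T0 m0 e0 f01; rewrite -meanZ -[X in X + _](mean_cst e T0) -meanD.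
apply: ler_mean => x; have /andP[f0 f1] := f01 x; rewrite -exprMn.
have -> : 2 / e * (f x / 2) = f x / e by field; rewrite gt_eqF.
have [fe|/ltW ef] := leP (f x) e.
  by rewrite ler_wpDr// exprn_ge0// divr_ge0// ltW.
rewrite ler_wpDl ?(ltW e0)// (le_trans f1)// exprn_ege1//.
by rewrite ler_pdivlMr// mul1r.
Qed.

Lemma sum_power_mean_objective k (H : 'I_k -> finite_graph) (beta : 'I_k -> R) n
    (W : 'I_n -> 'I_n -> R) :
  \sum_(i < k) beta i * mean (fun q => W q.1 q.2 ^+ nedges (H i)) -
    mean (fun q => rate (W q.1 q.2)) =
  mean (fun q => scalar_objective H beta (W q.1 q.2)).
Proof.
rewrite /scalar_objective meanB mean_sum; congr (_ - _).
by apply: eq_bigr => i _; rewrite meanZ.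
Qed.

(** The values of [W] must nearly maximize the scalar objective; if that has
    several maximizers, the strict deficit in AM-GM for a graph with two edges
    forces all the values to lie near the same one. *)
Lemma near_maximizer_near_constant k (H : 'I_k.+1 -> finite_graph) (beta : 'I_k.+1 -> R)
    (U : set R) (L : R) :
  nedges (H ord0) = 1%N -> (forall i, (0 < nedges (H i))%N) ->
  (forall i, i != ord0 -> 0 <= beta i) ->
  (forall v, 0 <= v <= 1 -> scalar_objective H beta v <= L) ->
  (forall u, U u -> 0 <= u <= 1) ->
  (forall e, 0 < e -> exists2 kappa, 0 < kappa & forall v, 0 <= v <= 1 ->
     L - scalar_objective H beta v < kappa -> exists2 u, U u & `|v - u| < e) ->
  (exists i, 0 < beta i /\ (2 <= nedges (H i))%N) \/ (forall u v, U u -> U v -> u = v) ->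
  forall e, 0 < e -> exists2 delta, 0 < delta &
    forall n (W : 'I_n -> 'I_n -> R), (0 < n)%N ->
      (forall i j, 0 <= W i j <= 1) -> (forall i j, W i j = W j i) ->
      L - delta <= \sum_(i < k.+1) beta i * hom_mean (H i) W - mean (fun q => rate (W q.1 q.2)) ->
      exists2 u, U u & mean (fun q => `|W q.1 q.2 - u|) <= e.
Proof.
move=> H0 H_edge beta_ge0 Lmax U01 kappaP cases e e0.
have e20 : 0 < e / 2 by rewrite divr_gt0.
have [kappa kappa0 kP] := kappaP _ e20.
pose gap n (W : 'I_n -> 'I_n -> R) := mean (fun q => L - scalar_objective H beta (W q.1 q.2)).
have term_le n (W : 'I_n -> 'I_n -> R) i : (0 < n)%N -> (forall i j, 0 <= W i j <= 1) ->
    beta i * hom_mean (H i) W <= beta i * mean (fun q => W q.1 q.2 ^+ nedges (H i)).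
  move=> n0 W01; have [->|i0] := eqVneq i ord0; last by rewrite ler_wpM2l ?beta_ge0// hom_mean_le_power.
  by rewrite hom_mean_edge// H0.
have n20 n : (0 < n)%N -> (0 < #|{: 'I_n * 'I_n}|)%N by move=> n0; rewrite card_prod card_ord muln_gt0 n0.
have gapE n (W : 'I_n -> 'I_n -> R) : (0 < n)%N ->
    gap n W = L - mean (fun q => scalar_objective H beta (W q.1 q.2)).
  by move=> n0; rewrite /gap meanB (mean_cst _ (n20 n n0)).
have gap_ge0 n (W : 'I_n -> 'I_n -> R) q : (forall i j, 0 <= W i j <= 1) ->
    0 <= L - scalar_objective H beta (W q.1 q.2).
  by move=> W01; rewrite subr_ge0 Lmax.
case: cases => [[i [bi Hi]]|U1]; last first.
  pose r := Num.min 1 e / 2.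
  have r0 : 0 < r by rewrite divr_gt0// lt_min ltr01.
  have r1 : r < 1.
    by rewrite /r ltr_pdivrMr// mul1r (@le_lt_trans _ _ 1) ?ltr1n// ge_min lexx.
  have re : r <= e / 2 by rewrite ler_pM2r ?invr_gt0// ge_min lexx orbT.
  exists (kappa * r); first by rewrite mulr_gt0.
  move=> n W n0 W01 Ws near.
  have gap_le : gap n W <= kappa * r.
    rewrite gapE// -sum_power_mean_objective lerBlDl -lerBlDr (le_trans near)//.
    by rewrite lerD2r; apply: ler_sum => i _; exact: term_le.
  have [q qk] : exists q : 'I_n * 'I_n, L - scalar_objective H beta (W q.1 q.2) < kappa.
    apply: (mean_lt_ex (n20 n n0)); apply: le_lt_trans gap_le _.
    by rewrite -[ltRHS]mulr1 ltr_pM2l.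
  have [u Uu _] := kP _ (W01 q.1 q.2) qk; exists u => //.
  apply: (@le_trans _ _ (e / 2 + kappa^-1 * gap n W)).
    rewrite -[X in X + _](mean_cst (e / 2) (n20 n n0)) -meanZ -meanD; apply: ler_mean => p.
    have [pk|kp] := ltP (L - scalar_objective H beta (W p.1 p.2)) kappa.
      have [v Uv /ltW vP] := kP _ (W01 p.1 p.2) pk; rewrite (U1 _ _ Uu Uv).
      by rewrite ler_wpDr// mulr_ge0 ?invr_ge0 ?(ltW kappa0)// gap_ge0.
    rewrite ler_wpDl ?(ltW e20)// (le_trans (unit_dist_le1 (W01 p.1 p.2) (U01 _ Uu)))//.
    by rewrite ler_pdivlMl// mulr1.
  have : kappa^-1 * gap n W <= r by rewrite ler_pdivrMl.
  lra.
set m := nedges (H i) in Hi.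
have m0 : 0 < m%:R :> R by rewrite ltr0n (leq_trans _ Hi).
pose eta := e / 16; have eta0 : 0 < eta by rewrite divr_gt0.
pose c := (2 / eta) ^+ (2 * m).
have c0 : 0 < c by rewrite exprn_gt0// divr_gt0.
have [k0 [l0 [kH lH kl]]] : exists k0 l0, [/\ k0 \in edge_pairs (H i), l0 \in edge_pairs (H i) & k0 != l0].
  by apply/card_gt1P; rewrite card_edge_pairs.
pose d1 := kappa / 4; pose d2 := beta i / m%:R * (eta / c).
have d10 : 0 < d1 by rewrite divr_gt0.
have d20 : 0 < d2 by rewrite mulr_gt0 ?divr_gt0.
exists (Num.min d1 d2); first by rewrite lt_min d10.
move=> n W n0 W01 Ws near.
pose dist (phi : {ffun 'I_(nvertices (H i)) -> 'I_n}) :=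
  `|W (phi k0.1) (phi k0.2) - W (phi l0.1) (phi l0.2)|.
pose M := mean (fun phi => (dist phi / 2) ^+ (2 * m)).
have F0 : (0 < #|{ffun 'I_(nvertices (H i)) -> 'I_n}|)%N.
  by rewrite card_ffun !card_ord expn_gt0 n0.
have dist01 phi : 0 <= dist phi <= 1 by rewrite normr_ge0 unit_dist_le1.
have M0 : 0 <= M.
  by apply: mean_ge0 => phi; rewrite exprn_ge0// divr_ge0//; case/andP: (dist01 phi).
have gapM : gap n W + beta i / m%:R * M <= Num.min d1 d2.
  rewrite gapE// -sum_power_mean_objective.
  have : \sum_(i < k.+1) beta i * hom_mean (H i) W <=
      \sum_(i < k.+1) beta i * mean (fun q => W q.1 q.2 ^+ nedges (H i)) - beta i / m%:R * M.
    rewrite (bigD1 i)//= [in leRHS](bigD1 i)//= addrAC lerD//.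
      rewrite -mulrA -mulrBr ler_pM2l//.
      exact: hom_mean_le_power_deficit kH lH kl.
    by apply: ler_sum => j _; exact: term_le.
  move: near; move: (mean _) (Num.min _ _) (_ * M) => x y z.
  move: (\sum_(i < k.+1) _) (\sum_(i < k.+1) _) => s t; lra.
have gap0 : 0 <= gap n W by apply: mean_ge0 => q; exact: gap_ge0.
have bM0 : 0 <= beta i / m%:R * M by rewrite mulr_ge0// divr_ge0// ltW.
have gap_le : gap n W <= d1.
  by have : Num.min d1 d2 <= d1 by [rewrite ge_min lexx]; lra.
have M_le : M <= eta / c.
  have : beta i / m%:R * M <= d2.
    by have : Num.min d1 d2 <= d2 by [rewrite ge_min lexx orbT]; lra.
  by rewrite ler_pM2l// divr_gt0.
have dist_le : mean dist <= 2 * eta.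
  have m20 : (0 < 2 * m)%N by rewrite muln_gt0 (leq_trans _ Hi).
  apply: le_trans (mean_norm_le_power F0 m20 eta0 dist01) _; rewrite -/c -/M.
  have : c * M <= eta by rewrite -ler_pdivlMl// mulrC.
  lra.
have DD := two_edges n0 Ws kH lH kl; rewrite -/(mean dist) in DD.
set D := mean (fun q => mean _) in DD.
have [q] : exists q : 'I_n * 'I_n, (e / 2)^-1 * mean (fun p => `|W p.1 p.2 - W q.1 q.2|) +
    kappa^-1 * (L - scalar_objective H beta (W q.1 q.2)) < 1.
  apply: (mean_lt_ex (n20 n n0)); rewrite meanD meanZ [X in _ + X]meanZ -/D -/(gap n W).
  have : (e / 2)^-1 * D <= 1 / 2.
    by rewrite ler_pdivrMl//; move: dist_le DD; rewrite /eta; lra.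
  have : kappa^-1 * gap n W <= 1 / 4 by rewrite ler_pdivrMl//; move: gap_le; rewrite /d1; lra.
  by move: (_ * D) (_ * gap n W) => a b; lra.
set x := mean _; set y := L - _ => xy.
have x0 : 0 <= x by apply: mean_ge0.
have y0 : 0 <= y by exact: gap_ge0.
have x1 : x < e / 2.
  rewrite -[ltRHS]mulr1 -ltr_pdivrMl//; apply: le_lt_trans xy.
  by rewrite lerDl mulr_ge0 ?invr_ge0 ?(ltW kappa0).
have y1 : y < kappa.
  rewrite -[ltRHS]mulr1 -ltr_pdivrMl//; apply: le_lt_trans xy.
  by rewrite lerDr mulr_ge0 ?invr_ge0 ?(ltW e20).
have [u Uu uP] := kP _ (W01 q.1 q.2) y1; exists u => //.
apply: (@le_trans _ _ (x + `|W q.1 q.2 - u|)); last by lra.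
rewrite -[X in _ + X](mean_cst _ (n20 n n0)) -meanD; apply: ler_mean => p.
exact: ler_distD.
Qed.

End stability.

(** * Calculus of the scalar objective *)

Import numFieldNormedType.Exports.
Local Open Scope classical_set_scope.
Local Open Scope ring_scope.

Section scalar.
Variable R : realType.

(** Near [0], [x ln x] is controlled by a square root, as
    [ln x = 2 ln (sqrt x)] and [ln (1 / y) <= 1 / y]. *)
Lemma xlnx_le_sqrt (x : R) : 0 < x <= 1 -> `|x * ln x| <= 2 * Num.sqrt x.
Proof.
move=> /andP[x0 x1]; pose y := Num.sqrt x.
have y0 : 0 < y by rewrite sqrtr_gt0.
have xE : x = y ^+ 2 by rewrite sqr_sqrtr// ltW.
have := ln_sublinear (_ : 0 < y^-1); rewrite invr_gt0 lnV// => /(_ y0) ly.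
have lnx : ln x = 2 * ln y by rewrite xE lnXn// mulr_natl.
rewrite -/y normrM (gtr0_norm x0) ler0_norm ?ln_le0// lnx xE.
have -> : 2 * y = y ^+ 2 * (2 * y^-1) by field; rewrite gt_eqF.
by rewrite ler_pM2l ?exprn_gt0// -mulrN ler_pM2l// ltW.
Qed.

Lemma continuous_xlnx : continuous (fun x : R => x * ln x).
Proof.
move=> x; have [x0|x0|->] := ltgtP x 0.
- rewrite /continuous_at [X in _ --> X](_ : _ = 0); last by rewrite ln0 ?mulr0// ltW.
  apply: cvg_near_cst; near=> y.
  by rewrite ln0 ?mulr0//; apply: ltW; near: y; exact: lt_nbhsl.
- by apply: cvgM; [exact: cvg_id|exact: continuous_ln].
- rewrite /continuous_at mul0r; apply/cvgr0Pnorm_lt => e e0.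
  have e1 : 0 < Num.min 1 ((e / 2) ^+ 2) by rewrite lt_min ltr01 exprn_gt0// divr_gt0.
  near=> y.
  have : `|y| < Num.min 1 ((e / 2) ^+ 2) by near: y; apply: (@nbhs0_lt R R).
  rewrite lt_min => /andP[y1 ye].
  have [y0|y0] := leP y 0; first by rewrite ln0// mulr0 normr0.
  rewrite gtr0_norm// in y1 ye.
  have y01 : 0 < y <= 1 by rewrite y0 ltW.
  apply: le_lt_trans (xlnx_le_sqrt y01) _.
  rewrite -ltr_pdivlMl// mulrC -(@ltr_pXn2r _ 2) ?nnegrE ?sqrtr_ge0 ?divr_ge0 ?(ltW e0)//.
  by rewrite sqr_sqrtr// ltW.
Unshelve. all: by end_near.
Qed.

Lemma continuous_rate : continuous (@rate R).
Proof.
move=> x; rewrite /continuous_at /rate.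
apply: cvgD.
  under eq_fun do rewrite -mulrA; rewrite -mulrA.
  apply: cvgMr; exact: continuous_xlnx.
under eq_fun do rewrite -mulrA; rewrite -mulrA.
apply: cvgMr.
have h : {for x, continuous ((fun x : R => x * ln x) \o (fun x : R => 1 - x))}.
  apply: continuous_comp; last exact: continuous_xlnx.
  by apply: cvgB; [exact: cvg_cst|exact: cvg_id].
exact: h.
Qed.

Section objective.
Variables (k : nat) (H : 'I_k -> finite_graph) (beta : 'I_k -> R).

Definition statistic_poly : {poly R} := \sum_(i < k) beta i *: 'X^(nedges (H i)).

Lemma scalar_objectiveE u : scalar_objective H beta u = statistic_poly.[u] - rate u.
Proof.
rewrite /scalar_objective /statistic_poly horner_sum; congr (_ - _).
by apply: eq_bigr => i _; rewrite hornerZ hornerXn.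
Qed.

Lemma continuous_scalar_objective : continuous (scalar_objective H beta).
Proof.
rewrite (_ : scalar_objective H beta = fun u => statistic_poly.[u] - rate u); last first.
  by apply/funext => u; exact: scalar_objectiveE.
by move=> x; apply: cvgB; [exact: continuous_horner|exact: continuous_rate].
Qed.

Definition dobjective u := statistic_poly^`().[u] - 2^-1 * (ln u - ln (1 - u)).

Definition ddobjective u := statistic_poly^`()^`().[u] - 2^-1 * (u^-1 + (1 - u)^-1).

Lemma is_derive_ln1B (u : R) : u < 1 -> is_derive u 1 (fun x : R => ln (1 - x)) (- (1 - u)^-1).
Proof.
move=> u1; have h : 0 < 1 - u by rewrite subr_gt0.
have d1 : is_derive u 1 (fun x : R => 1 - x) (- 1).
  by apply: is_derive_eq; ring.
by have := @is_derive1_comp R (@ln R) (fun x => 1 - x) u _ _ (is_derive1_ln h) d1; rewrite mulrN1.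
Qed.

Lemma is_derive_objective (u : R) : 0 < u < 1 ->
  is_derive u 1 (scalar_objective H beta) (dobjective u).
Proof.
move=> /andP[u0 u1].
have -> : scalar_objective H beta = fun u : R => statistic_poly.[u] -
    (2^-1 * u * ln u + 2^-1 * (1 - u) * ln (1 - u)).
  by apply/funext => v; exact: scalar_objectiveE.
have dl := is_derive1_ln u0; have dl1 := is_derive_ln1B u1.
apply: is_derive_eq; rewrite /dobjective /GRing.scale /=.
have u0' : u != 0 by rewrite gt_eqF.
have u1' : 1 - u != 0 by rewrite gt_eqF ?subr_gt0.
by field; rewrite u0' u1'.
Qed.

Lemma is_derive_dobjective (u : R) : 0 < u < 1 ->
  is_derive u 1 dobjective (ddobjective u).
Proof.
move=> /andP[u0 u1].
have dl := is_derive1_ln u0; have dl1 := is_derive_ln1B u1.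
rewrite /dobjective; apply: is_derive_eq; rewrite /ddobjective /GRing.scale /=.
have u0' : u != 0 by rewrite gt_eqF.
have u1' : 1 - u != 0 by rewrite gt_eqF ?subr_gt0.
by field; rewrite u0' u1'.
Qed.

Lemma subitv_unit (u v t : R) : 0 <= u -> v <= 1 -> t \in `]u, v[ -> 0 < t < 1.
Proof.
move=> u0 v1; rewrite in_itv/= => /andP[ut tv].
by rewrite (le_lt_trans u0 ut) (lt_le_trans tv v1).
Qed.

Definition is_max (u : R) :=
  0 <= u <= 1 /\ forall v, 0 <= v <= 1 -> scalar_objective H beta v <= scalar_objective H beta u.

(** Rolle gives a critical point between two maximizers.  The objective there
    does not exceed its maximum at [u], so its derivative is nonpositive
    somewhere before the critical point, where it vanishes. *)
Lemma ddobjective_between_max (u v : R) : is_max u -> is_max v -> u < v ->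
  exists2 t, 0 < t < 1 & 0 <= ddobjective t.
Proof.
move=> [/andP[u0 u1] umax] [/andP[v0 v1] vmax] uv.
have cont a b : {within `[a, b], continuous (scalar_objective H beta)}.
  by apply: continuous_subspaceT; exact: continuous_scalar_objective.
have fuv : scalar_objective H beta u = scalar_objective H beta v.
  by apply/le_anti; rewrite umax ?vmax ?u0 ?v0.
have [c cuv dc] : exists2 c, c \in `]u, v[ & is_derive c 1 (scalar_objective H beta) 0.
  apply: Rolle => // x /(subitv_unit u0 v1) x01.
  by have [] := is_derive_objective x01.
have c01 := subitv_unit u0 v1 cuv.
have dc0 : dobjective c = 0.
  by have [_ <-] := is_derive_objective c01; have [_ ->] := dc.
have {}cuv : u < c by move: cuv; rewrite in_itv => /andP[].
have c1 : c <= 1 by case/andP: c01 => _ /ltW.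
have [d duc Ed] : exists2 d, d \in `]u, c[ &
    scalar_objective H beta c - scalar_objective H beta u = dobjective d * (c - u).
  by apply: MVT => // x /(subitv_unit u0 c1); exact: is_derive_objective.
have d01 := subitv_unit u0 c1 duc.
have d0 : dobjective d <= 0.
  rewrite -(@pmulr_lle0 _ (c - u)) ?subr_gt0// -Ed subr_le0 umax//.
  by case/andP: c01 => /ltW -> _.
have dc' : d < c by move: duc; rewrite in_itv => /andP[].
have d0' : 0 <= d by case/andP: d01 => /ltW.
have [t tdc Et] : exists2 t, t \in `]d, c[ & dobjective c - dobjective d = ddobjective t * (c - d).
  apply: MVT => // [x /(subitv_unit d0' c1)|]; first exact: is_derive_dobjective.
  apply: derivable_within_continuous => x; rewrite in_itv/= => /andP[dx xc].
  have x01 : 0 < x < 1.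
    case/andP: d01 => d0'' _; case/andP: c01 => _ c1'.
    by rewrite (lt_le_trans d0'' dx) (le_lt_trans xc c1').
  by have [] := is_derive_dobjective x01.
exists t; first exact: subitv_unit tdc.
by rewrite -(@pmulr_lge0 _ (c - d)) ?subr_gt0// -Et dc0 sub0r oppr_ge0.
Qed.

Lemma dobjective_max (u : R) : 0 < u < 1 -> is_max u -> dobjective u = 0.
Proof.
move=> u01 [_ umax].
have [_ <-] := is_derive_objective u01.
have [||||_ ->//] := @derive1_at_max R (scalar_objective H beta) 0 1 u.
- exact: ler01.
- by move=> t; rewrite in_itv/= => t01; have [] := is_derive_objective t01.
- by rewrite in_itv.
- by move=> t; rewrite in_itv/= => /andP[t0 t1]; rewrite umax// !ltW.
Qed.

Lemma ddobjective_zero_between (u v : R) : 0 < u -> v < 1 -> is_max u -> is_max v ->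
  u < v -> exists2 t, u < t < v & ddobjective t = 0.
Proof.
move=> u0 v1 umax vmax uv.
have [|||c cuv dc] := @Rolle R dobjective u v uv.
- move=> x /(subitv_unit (ltW u0) (ltW v1)) x01.
  by have [] := is_derive_dobjective x01.
- apply: derivable_within_continuous => x; rewrite in_itv/= => /andP[ux xv].
  have x01 : 0 < x < 1 by rewrite (lt_le_trans u0 ux) (le_lt_trans xv v1).
  by have [] := is_derive_dobjective x01.
- by rewrite !dobjective_max// ?v1 ?u0 ?andbT ?(lt_trans u0 uv)// (lt_trans uv v1).
have c01 := subitv_unit (ltW u0) (ltW v1) cuv.
exists c; first by rewrite in_itv in cuv.
by have [_ <-] := is_derive_dobjective c01; have [_ ->] := dc.
Qed.

End objective.
End scalar.

(** * Maximizers of the scalar objective *)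

Section maximizers.
Variable R : realType.

Lemma poly_roots_seq (p : {poly R}) : p != 0 -> exists s : seq R, forall x, root p x -> x \in s.
Proof.
move=> p0; apply: contrapT => /forallNP nos.
have grow n : exists s : seq R, [/\ size s = n, uniq s & all (root p) s].
  elim: n => [|n [s [sn us rs]]]; first by exists [::].
  have [x /not_implyP[rx /negP xs]] := (existsNP _).2 (nos s).
  by exists (x :: s); rewrite /= sn xs rx.
have [s [sn us rs]] := grow (size p).
by have := max_poly_roots p0 rs us; rewrite sn ltnn.
Qed.

Variables (k : nat) (H : 'I_k.+1 -> finite_graph) (beta : 'I_k.+1 -> R).
Local Notation ismax := (is_max H beta).

Let objective_within A : {within A, continuous (scalar_objective H beta)}.
Proof. by apply: continuous_subspaceT; exact: continuous_scalar_objective. Qed.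

Lemma ex_is_max : exists u, ismax u.
Proof.
have [u u01 umax] := EVT_max ler01 (objective_within (A := `[0, 1])).
by exists u; split => [|v v01]; [rewrite in_itv in u01|apply: umax; rewrite in_itv].
Qed.

(** Clearing denominators, the zeros of the second derivative are roots of a
    polynomial with constant coefficient [-1]; two interior maximizers are
    separated by such a root, hence determined by their position among them. *)
Lemma finite_is_max : finite_set [set u | ismax u].
Proof.
pose P2 := (statistic_poly H beta)^`()^`().
pose q : {poly R} := 2%:P * ('X * (1 - 'X) * P2) - 1.
have qE t : q.[t] = 2 * (t * (1 - t) * P2.[t]) - 1 by rewrite /q !hornerE.
(* the value at [0] is [-1] *)
have q0 : q != 0.
  apply/eqP => qz; have := qE 0; rewrite qz horner0; lra.
have [s sP] := poly_roots_seq q0.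
pose E := [set u | ismax u /\ 0 < u < 1].
pose f (u : R) := [tuple of map (fun r => r < u) (in_tuple s)].
have f_lt u v : E u -> E v -> u < v -> f u <> f v.
  move=> [um /andP[u0 u1]] [vm /andP[v0 v1]] uv /(congr1 val) /= fuv.
  have [t /andP[ut tv] dt] := ddobjective_zero_between u0 v1 um vm uv.
  have ts : t \in s.
    apply: sP; rewrite /root qE; apply/eqP.
    have t0 : t != 0 by rewrite gt_eqF// (lt_trans u0).
    have t1 : 1 - t != 0 by rewrite gt_eqF// subr_gt0 (lt_trans tv).
    have -> : P2.[t] = 2^-1 * (t^-1 + (1 - t)^-1).
      by apply/eqP; rewrite -subr_eq0; apply/eqP.
    by field; rewrite t0 t1.
  have /(_ t ts) /= := (eq_in_map _ _ _).2 fuv; rewrite tv => /(lt_trans ut).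
  by rewrite ltxx.
have f_inj : {in E &, injective f}.
  move=> u v; rewrite !inE => Eu Ev fuv; have [uv|vu|//] := ltgtP u v.
    by have := f_lt _ _ Eu Ev uv.
  by have := f_lt _ _ Ev Eu vu; rewrite fuv.
have fE : finite_set E by rewrite -(eq_finite_set (inj_card_eq f_inj)).
apply: (@sub_finite_set _ _ (E `|` [set 0; 1])).
  move=> u um; have [/andP[u0 u1] _] := um.
  have [->|u0'] := eqVneq u 0; first by right; left.
  have [->|u1'] := eqVneq u 1; first by right; right.
  by left; split => //; rewrite !lt_neqAle u0 u1 eq_sym u0' u1'.
by rewrite !finite_setU.
Qed.

(** Compactness of the points that are far from all maximizers. *)
Lemma near_max_near_is_max (e L : R) : 0 < e ->
  (exists2 u, ismax u & scalar_objective H beta u = L) ->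
  exists2 kappa, 0 < kappa & forall v, 0 <= v <= 1 ->
    L - scalar_objective H beta v < kappa -> exists2 u, ismax u & `|v - u| < e.
Proof.
move=> e0 [w [w01 wmax] wL].
pose far u := [set v : R | e <= `|v - u|].
pose K := `[0, 1] `&` \bigcap_(u in [set u | ismax u]) far u.
have notK v : 0 <= v <= 1 -> ~ K v -> exists2 u, ismax u & `|v - u| < e.
  move=> v01 nK; apply: contrapT => nu; apply: nK; split; first by rewrite /= in_itv.
  by move=> u um; rewrite /far /= leNgt; apply/negP => vu; apply: nu; exists u.
have [K0|/nonemptyPn KE] := pselect (K !=set0); last first.
  by exists 1 => // v v01 _; apply: notK; rewrite ?KE.
have farC u : closed (far u).
  apply: (@preimage_closed _ _ (fun v : R => `|v - u|) [set x | e <= x]).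
    move=> x _; apply: (@continuous_comp _ _ _ (fun v : R => v - u) (fun y => `|y|)).
      by apply: cvgB; [exact: cvg_id|exact: cvg_cst].
    exact: norm_continuous.
  exact: closed_ge.
have cK : compact K.
  apply: (subclosed_compact _ (@segment_compact R 0 1)) => [|x []//].
  apply: closedI; first exact: itv_closed.
  by apply: closed_bigI => u _; exact: farC.
have [c cK' cmax] := compact_EVT_max K0 cK (objective_within (A := K)).
have [c01 cfar] := set_mem cK'; rewrite /= in_itv /= in c01.
exists (L - scalar_objective H beta c).
  rewrite subr_gt0 ltNge; apply/negP => Lc.
  have cm : ismax c by split => // v v01; apply: le_trans Lc; rewrite -wL wmax.
  by have := cfar c cm; rewrite /far /= subrr normr0 leNgt e0.
move=> v v01; rewrite ltrD2l ltrN2 => cv; apply: notK => // Kv.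
by have := cmax v (mem_set Kv); rewrite leNgt cv.
Qed.

(** Without a graph with two edges and positive weight the statistic is affine,
    so the scalar objective is strictly concave. *)
Lemma is_max_unique u v : nedges (H ord0) = 1%N -> (forall i, (0 < nedges (H i))%N) ->
  (forall i, i != ord0 -> 0 <= beta i) ->
  ~ (exists i, 0 < beta i /\ (2 <= nedges (H i))%N) -> ismax u -> ismax v -> u = v.
Proof.
move=> H0 H_edge beta_ge0 nlin.
have P2 : (statistic_poly H beta)^`()^`() = 0.
  rewrite /statistic_poly !raddf_sum big1// => i _ /=.
  have [i0|i0] := eqVneq i ord0; first by rewrite i0 H0 !derivZ derivX derivC scaler0.
  have := beta_ge0 i i0; rewrite le_eqVlt => /predU1P[<-|bi].
    by rewrite scale0r !deriv0.
  have -> : nedges (H i) = 1%N.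
    apply/eqP; rewrite eqn_leq H_edge andbT leqNgt; apply/negP => Hi.
    by apply: nlin; exists i.
  by rewrite !derivZ derivX derivC scaler0.
have lt_false x y : ismax x -> ismax y -> x < y -> False.
  move=> xm ym xy; have [t /andP[t0 t1]] := ddobjective_between_max xm ym xy.
  rewrite /ddobjective P2 horner0 sub0r oppr_ge0 leNgt => /negP; apply.
  by rewrite mulr_gt0// addr_gt0// invr_gt0// subr_gt0.
by move=> um vm; have [uv|vu|//] := ltgtP u v; exfalso; [apply: lt_false uv|apply: lt_false vu].
Qed.

End maximizers.

(** * Step graphons and the cut distance *)

Lemma integral_step_function d (T : measurableType d) (R : realType)
    (m : {measure set T -> \bar R}) (D : set T) (F : finType) (c : F -> R) (B : F -> set T) :
  measurable D -> (forall i, measurable (B i)) -> (forall i, 0 <= c i) ->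
  (\int[m]_(x in D) (\sum_i c i * \1_(B i) x)%:E = \sum_i (c i)%:E * m (B i `&` D))%E.
Proof.
move=> mD mB c0.
under eq_integral do rewrite -sumEFin.
rewrite ge0_integral_sum//=; last 2 first.
- move=> i; apply/measurable_EFinP; apply: measurable_funM => //.
- by move=> i x _; rewrite lee_fin mulr_ge0.
apply: eq_bigr => i _; under eq_integral do rewrite EFinM.
rewrite ge0_integralZl//= ?integral_indic//.
- exact/measurable_EFinP/measurable_indic.
- by rewrite lee_fin.
Qed.

Section cells.
Variable R : realType.
Local Notation mR := (measurableTypeR R).
Local Notation mu := (@lebesgue_measure R).
Local Notation I := (`[0%R, 1%R]%classic : set mR).
Local Notation J := (`]0%R, 1%R]%classic : set mR).

(** The inverse image of a vertex under the map defining the graphon of a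
    graph; it is half-open, and none of them contains [0]. *)
Definition cell n (i : 'I_n) : set mR := [set x : R | Num.ceil (n%:R * x) == i.+1%:Z].

Lemma cellE n (i : 'I_n) : (0 < n)%N -> cell i = `]i%:R / n%:R, i.+1%:R / n%:R]%classic.
Proof.
move=> n0; have n0' : 0 < n%:R :> R by rewrite ltr0n.
apply/seteqP; split => x; rewrite /cell /= ceil_eq in_itv /= ltr_pdivrMr// ler_pdivlMr//.
  by rewrite mulrC rmorphB /= -!pmulrn -natr1 addrK.
by rewrite mulrC rmorphB /= -!pmulrn -natr1 addrK.
Qed.

Lemma measurable_cell n (i : 'I_n) : measurable (cell i).
Proof. by rewrite cellE ?(leq_ltn_trans _ (ltn_ord i))//; exact: measurable_itv. Qed.

Lemma mu_cell n (i : 'I_n) : mu (cell i) = (n%:R^-1)%:E.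
Proof.
have n0 : (0 < n)%N by rewrite (leq_ltn_trans _ (ltn_ord i)).
have n0' : 0 < n%:R :> R by rewrite ltr0n.
rewrite cellE// lebesgue_measure_itv /= lte_fin ltr_pM2r ?invr_gt0// ltr_nat ltnSn.
by rewrite -EFinB -mulrBl -natr1 addrAC subrr add0r mul1r.
Qed.

Lemma cell_ceil_inj n (i j : 'I_n) x : cell i x -> cell j x -> i = j.
Proof. by rewrite /cell /= => /eqP -> /eqP [/val_inj]. Qed.

Lemma cellP n (x : R) : (0 < n)%N -> J x <-> exists i : 'I_n, cell i x.
Proof.
move=> n0; have n0' : 0 < n%:R :> R by rewrite ltr0n.
rewrite /= in_itv /=; split => [/andP[x0 x1]|[i]]; last first.
  rewrite cellE//= in_itv /= => /andP[ix xi].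
  rewrite (le_lt_trans _ ix) ?divr_ge0//= (le_trans xi)// ler_pdivrMr// mul1r ler_nat.
  exact: ltn_ord.
have c0 : 0 < Num.ceil (n%:R * x) by rewrite ceil_gt0 mulr_gt0.
have cn : Num.ceil (n%:R * x) <= n%:Z by rewrite ceil_le_int -pmulrn ler_piMr// ltW.
case E : (Num.ceil (n%:R * x)) c0 cn => [[|c]|c] // _.
by rewrite lez_nat => cn; exists (Ordinal cn); rewrite /cell /= E.
Qed.

Lemma cell_sub n (i : 'I_n) : cell i `<=` J.
Proof. by move=> x ix; apply/(@cellP n); [exact: leq_ltn_trans (ltn_ord i)|exists i]. Qed.

Lemma sum_indic_cell n (x : R) : (0 < n)%N -> \sum_(i < n) \1_(cell i) x = \1_J x :> R.
Proof.
move=> n0; rewrite [RHS]indicE; case: (pselect (J x)) => [Jx|nJ].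
  have [i ix] := (cellP x n0).1 Jx; rewrite mem_set// (bigD1 i)//= indicE mem_set//.
  rewrite big1 ?addr0// => j ji; rewrite indicE memNset// => jx.
  by move: ji; rewrite (cell_ceil_inj ix jx) eqxx.
rewrite memNset// big1// => i _; rewrite indicE memNset// => /cell_sub; exact: nJ.
Qed.

Lemma JI : J `<=` I.
Proof. by move=> x; rewrite /= !in_itv /= => /andP[/ltW -> ->]. Qed.

(** Only the point [0] is missed by the cells. *)
Lemma mu_sum_cell n (S : set mR) : (0 < n)%N -> measurable S -> S `<=` I ->
  mu S = (\sum_(i < n) mu (cell i `&` S))%E.
Proof.
move=> n0 mS SI.
have mJ : measurable J by exact: measurable_itv.
transitivity (mu (J `&` S)).
  rewrite [X in mu X = _](_ : S = (J `&` S) `|` ([set 0] `&` S)); last first.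
    apply/seteqP; split => [x Sx|x [[]|[]]//].
    have := SI x Sx; rewrite /= in_itv /= => /andP[]; rewrite le_eqVlt => /predU1P[x0|x0] x1.
      by right; split => //=.
    by left; split => //=; rewrite in_itv /= x0.
  rewrite measureU//; last 3 first.
  - exact: measurableI.
  - by apply: measurableI => //; exact: measurable_set1.
  - by apply/seteqP; split => // x [[Jx _] [/= x0 _]]; move: Jx; rewrite x0 /= in_itv /= ltxx.
  rewrite [X in (_ + X)%E](_ : _ = 0%E) ?adde0//.
  apply/eqP; rewrite eq_le measure_ge0 andbT -(@lebesgue_measure_set1 R 0).
  by apply: le_measure; rewrite ?inE//; apply: measurableI => //; exact: measurable_set1.
rewrite -integral_indic//.
transitivity (\int[mu]_(x in S) (\sum_(i < n) 1 * \1_(cell i) x)%:E)%E.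
  by apply: eq_integral => x _; under eq_bigr do rewrite mul1r; rewrite sum_indic_cell.
rewrite (@integral_step_function _ _ _ mu S _ (fun _ => 1) (fun i : 'I_n => cell i)) //.
  by apply: eq_bigr => i _; rewrite mul1e.
by move=> i; exact: measurable_cell.
Qed.

Lemma graph_fun_cells n (G : simple_graph n) (x y : R) :
  graph_fun G x y = \sum_(p : 'I_n * 'I_n) adjR R G p.1 p.2 * \1_(cell p.1 `*` cell p.2) (x, y).
Proof.
rewrite /graph_fun; case: existsP => [[i /existsP[j /and3P[ij xi yj]]]|h] /=.
  rewrite (bigD1 (i, j))//= /adjR ij mul1r indicE mem_set//=.
  rewrite big1 ?addr0// => -[k l] /= kl; rewrite indicE memNset ?mulr0//= => -[xk yl].
  by move: kl; rewrite (cell_ceil_inj xk xi) (cell_ceil_inj yl yj) eqxx.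
rewrite big1// => -[i j] _ /=; rewrite /adjR indicE; case: (boolP (adj G i j)) => ij; last by rewrite mul0r.
rewrite mul1r memNset//= => -[xi yj]; apply: h; exists i; apply/existsP; exists j.
by rewrite ij xi yj.
Qed.

Lemma graph_fun_cell n (G : simple_graph n) (i j : 'I_n) (x y : R) :
  cell i x -> cell j y -> graph_fun G x y = adjR R G i j.
Proof.
move=> xi yj; rewrite graph_fun_cells (bigD1 (i, j))//= indicE mem_set//= mulr1.
rewrite big1 ?addr0// => -[k l] /= kl; rewrite indicE memNset ?mulr0//= => -[xk yl].
by move: kl; rewrite (cell_ceil_inj xk xi) (cell_ceil_inj yl yj) eqxx.
Qed.

(** The integral over a rectangle is the bilinear form of the cut norm at the
    normalized measures of the traces of its sides on the cells. *)
Lemma cut_dist_const_le n (G : simple_graph n) (u : {i01 R}) (e : R) : (0 < n)%N ->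
  cut_le (fun i j => adjR R G i j - u%:num) e ->
  cut_dist (graph_graphon R G) (const_graphon u) <= e.
Proof.
move=> n0 cut; have n0' : 0 < n%:R :> R by rewrite ltr0n.
apply: ge_sup (cut_values_nonempty _ _) _ => _ [S [A [mS mA SI AI ->]]].
have mD : measurable (S `*` A) by exact: measurableX.
have DI := rect_sub SI AI.
have fin : ((mu \x mu)%E (S `*` A) < +oo)%E by rewrite (le_lt_trans (mu2_fin mD DI)) ?ltry.
pose s (i : 'I_n) : R := fine (mu (cell i `&` S)).
pose a (j : 'I_n) : R := fine (mu (cell j `&` A)).
have muE (X : set mR) (i : 'I_n) : measurable X ->
    (mu (cell i `&` X) = (fine (mu (cell i `&` X)))%:E /\ 0 <= n%:R * fine (mu (cell i `&` X)) <= 1)%R.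
  move=> mX; have mc := measurable_cell i.
  have le : (mu (cell i `&` X) <= (n%:R^-1)%:E)%E.
    by rewrite -(mu_cell i); apply: le_measure; rewrite ?inE//; exact: measurableI.
  have fn : mu (cell i `&` X) \is a fin_num.
    by rewrite ge0_fin_numE ?measure_ge0// (le_lt_trans le) ?ltry.
  split; first by rewrite fineK.
  rewrite mulr_ge0 ?fine_ge0 ?measure_ge0//=.
  by rewrite -ler_pdivlMl// mulr1 -lee_fin fineK.
have mu_fin (X : set mR) : measurable X -> X `<=` I -> mu X = (\sum_(i < n) fine (mu (cell i `&` X)))%:E.
  move=> mX XI; rewrite (mu_sum_cell n0 mX XI) -sumEFin; apply: eq_bigr => i _.
  by have [] := muE X i mX.
have intf : (mu \x mu)%E.-integrable (S `*` A) (EFin \o (fun z => graph_fun G z.1 z.2)).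
  apply: measurable_bounded_integrable => //.
    by apply: measurable_funS (graphon_measurable (graph_graphon R G)) => //; exact: measurable_I2.
  exists 1; split; first exact: num_real.
  move=> x x1 z _; apply: le_trans (ltW x1).
  by rewrite /graph_fun; case: [exists i, _]; rewrite ?normr1 ?normr0.
have intu : (mu \x mu)%E.-integrable (S `*` A) (EFin \o (fun _ => u%:num)).
  by apply: measurable_bounded_integrable => //; exact: bounded_cst.
rewrite [X in `|X| <= _](_ : _ = \sum_(p : 'I_n * 'I_n) (adjR R G p.1 p.2 - u%:num) * (s p.1 * a p.2)).
  pose f i := n%:R * s i; pose g j := n%:R * a j.
  have f01 : unit_valued f by move=> i; have [] := muE S i mS.
  have g01 : unit_valued g by move=> i; have [] := muE A i mA.
  apply: le_trans (cut f g f01 g01); rewrite le_eqVlt; apply/orP; left; apply/eqP; congr `|_|.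
  rewrite -(mean_fun_pair (fun i j => (adjR R G i j - u%:num) * (f i * g j))) /mean.
  rewrite card_prod !card_ord natrM mulr_sumr; apply: eq_bigr => p _; rewrite /f /g.
  by field; rewrite gt_eqF.
rewrite [LHS](RintegralB mD intf intu) (Rintegral_cst _ mD).
have sumSA : fine ((mu \x mu)%E (S `*` A)) = \sum_(p : 'I_n * 'I_n) s p.1 * a p.2.
  rewrite product_measure1E//.
  rewrite [X in (X * _)%E](mu_fin _ mS SI) [X in (_ * X)%E](mu_fin _ mA AI) /=.
  rewrite mulr_suml -(pair_bigA _ (fun i j => s i * a j)) /=.
  by apply: eq_bigr => i _; rewrite mulr_sumr.
rewrite sumSA mulr_sumr; under [RHS]eq_bigr do rewrite mulrBl.
rewrite sumrB; congr (_ - _).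
rewrite /Rintegral.
under eq_integral => z do rewrite graph_fun_cells -surjective_pairing.
have mcc (p : 'I_n * 'I_n) : measurable (cell p.1 `*` cell p.2).
  by apply: measurableX; exact: measurable_cell.
have c0 (p : 'I_n * 'I_n) : 0 <= adjR R G p.1 p.2 by case/andP: (adjR01 R G p.1 p.2).
rewrite (integral_step_function (mu \x mu)%E mD mcc c0).
rewrite (eq_bigr (fun p : 'I_n * 'I_n => (adjR R G p.1 p.2 * (s p.1 * a p.2))%:E)) ?sumEFin// => p _.
have pE : (mu \x mu)%E ((cell p.1 `*` cell p.2) `&` (S `*` A)) =
    (mu (cell p.1 `&` S) * mu (cell p.2 `&` A))%E.
  rewrite -setXI product_measure1E//; apply: measurableI => //; exact: measurable_cell.
rewrite [X in (_ * X)%E]pE.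
have [sE _] := muE S p.1 mS; have [aE _] := muE A p.2 mA.
by rewrite [X in (_ * (X * _))%E]sE [X in (_ * (_ * X))%E]aE -!EFinM.
Qed.

End cells.

(** * Homomorphism densities of step graphons *)

Section hom_density.
Variable R : realType.
Local Notation mR := (measurableTypeR R).
Local Notation mu := (@lebesgue_measure R).
Local Notation I := (`[0%R, 1%R]%classic : set mR).
Local Notation J := (`]0%R, 1%R]%classic : set mR).

Definition box m (A : 'I_m -> set mR) : set (m.-tuple mR) := [set t | forall i, A i (tnth t i)].

Lemma measurable_box m (A : 'I_m -> set mR) : (forall i, measurable (A i)) ->
  measurable (box A).
Proof.
move=> mA; rewrite (_ : box A = \bigcap_(i in [set: 'I_m]) ((@tnth m mR)^~ i @^-1` A i)).
  apply: fin_bigcap_measurable => // i _; rewrite -[X in measurable X]setTI.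
  exact: measurable_tnth.
by apply/seteqP; split => t tA i; [move=> _; exact: tA|exact: tA].
Qed.

Lemma lebesgue_tuple_box m (A : 'I_m -> set mR) (a : 'I_m -> R) :
  (forall i, measurable (A i)) -> (forall i, mu (A i) = (a i)%:E) ->
  lebesgue_tuple R m (box A) = (\prod_i a i)%:E.
Proof.
elim: m A a => [|m IH] A a mA Aa.
  rewrite big_ord0 /= diracE mem_set//= => -[] //.
rewrite big_ord_recl EFinM /= /cons_measure /pushforward.
rewrite (_ : @tcons R m @^-1` box A = A ord0 `*` box (fun i => A (lift ord0 i))); last first.
  apply/seteqP; split => [[x t] tA|[x t] [/= xA tA] i].
    split => [|i] /=; first by have := tA ord0; rewrite /tcons /= (tnth_nth 0).
    by have := tA (lift ord0 i); rewrite /tcons /= !(tnth_nth 0).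
  have [->|[j ->]] : i = ord0 \/ exists j, i = lift ord0 j.
    by case: (unliftP ord0 i) => [j ->|->]; [right; exists j|left].
    by rewrite /tcons /= (tnth_nth 0).
  by have := tA j; rewrite /tcons /= !(tnth_nth 0).
rewrite product_measure1E//; last by apply: measurable_box.
by rewrite [X in (X * _)%E]Aa (IH _ (fun i => a (lift ord0 i))).
Qed.

Lemma mu_J : mu J = 1%:E.
Proof. by rewrite lebesgue_measure_itv/= lte_fin ltr01 oppr0 adde0. Qed.

(** Off the null set of points with a zero coordinate, the integrand is constant
    on the boxes of cells, which have equal measures and are indexed by the maps
    of vertices. *)
Lemma hom_density_graph (H : finite_graph) n (G : simple_graph n) : (0 < n)%N ->
  hom_density H (graph_graphon R G) = hom_mean H (adjR R G).
Proof.
move=> n0; set m := nvertices H.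
have mI : measurable I by exact: measurable_itv.
have mJ : measurable J by exact: measurable_itv.
pose D := box (fun _ : 'I_m => I); pose D' := box (fun _ : 'I_m => J).
have mD : measurable D by exact: measurable_box.
have mD' : measurable D' by exact: measurable_box.
have D'D : D' `<=` D by move=> t tJ i; exact/JI/tJ.
have DE : lebesgue_tuple R m D = 1%:E.
  by rewrite (lebesgue_tuple_box (a := fun _ => 1))//; [rewrite big1|move=> i; exact: mu_I].
have D'E : lebesgue_tuple R m D' = 1%:E.
  by rewrite (lebesgue_tuple_box (a := fun _ => 1))//; [rewrite big1|move=> i; exact: mu_J].
have N0 : lebesgue_tuple R m (D `\` D') = 0%E.
  rewrite measureD//; last by rewrite [X in (X < _)%E]DE ltry.
  by rewrite (setIidr D'D) [X in (X - _)%E]DE [X in (_ - X)%E]D'E subee.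
pose f (x : m.-tuple mR) := \prod_(i < m) \prod_(j < m | (i < j)%N && adj H i j)
  graph_graphon R G (tnth x i) (tnth x j).
have f_ge0 x : 0 <= f x.
  apply: prodr_ge0 => i _; apply: prodr_ge0 => j _.
  by rewrite /= /graph_fun ler0n.
have mf : measurable_fun D f.
  rewrite /f; apply: measurable_prod => i _.
  under eq_fun do rewrite big_mkcond.
  apply: measurable_prod => j _; case: ((i < j)%N && adj H i j); last exact: measurable_cst.
  apply: (@measurable_comp _ _ _ _ _ _ (I `*` I) (fun z : mR * mR => graph_graphon R G z.1 z.2 : mR)
     D (fun x : m.-tuple mR => (tnth x i, tnth x j))).
  - exact: measurable_I2.
  - by move=> _ [x Dx <-]; split; exact: Dx.
  - exact: graphon_measurable.
  - by apply: measurable_funTS; apply/measurable_fun_pairP; split; exact: measurable_tnth.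
pose c (phi : {ffun 'I_m -> 'I_n}) : R := \prod_(p in edge_pairs H) adjR R G (phi p.1) (phi p.2).
pose B (phi : {ffun 'I_m -> 'I_n}) : set (m.-tuple mR) := box (fun i => @cell R n (phi i)).
have mB phi : measurable (B phi) by apply: measurable_box => i; exact: measurable_cell.
have BE phi : lebesgue_tuple R m (B phi) = (n%:R^-1 ^+ m)%:E.
  rewrite (lebesgue_tuple_box (a := fun _ => n%:R^-1)) ?prodr_const ?card_ord// => i.
    exact: measurable_cell.
  exact: mu_cell.
have BD' phi : B phi `<=` D' by move=> t tB i; exact/cell_sub/tB.
have c_ge0 phi : 0 <= c phi.
  by apply: prodr_ge0 => p _; case/andP: (adjR01 R G (phi p.1) (phi p.2)).
have fE x : D' x -> f x = \sum_phi c phi * \1_(B phi) x.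
  move=> Dx.
  have [phi phiP] : exists phi : {ffun 'I_m -> 'I_n}, B phi x.
    have ex i : exists k : 'I_n, cell k (tnth x i) by apply/cellP => //; exact: Dx.
    by exists [ffun i => sval (cid (ex i))] => i; rewrite ffunE; case: cid.
  rewrite (bigD1 phi)//= indicE mem_set// mulr1 big1 ?addr0 => [|psi psiphi]; last first.
    rewrite indicE memNset ?mulr0// => psiP; move/eqP: psiphi; apply.
    by apply/ffunP => i; exact: cell_ceil_inj (psiP i) (phiP i).
  rewrite /f pair_big_dep /c; apply: eq_big => [[i j]|[i j] _] /=; first by rewrite inE.
  exact: graph_fun_cell.
rewrite /hom_density /Rintegral -/f.
have mfE : measurable_fun D (fun x => (f x)%:E) by exact/measurable_EFinP.
have f0 x : D x -> (0 <= (f x)%:E)%E by move=> _; rewrite lee_fin.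
rewrite (ge0_negligible_integral (measurableD mD mD') mD mfE f0 N0).
rewrite setDD setIidr//.
transitivity (fine (\int[lebesgue_tuple R m]_(x in D') (\sum_phi c phi * \1_(B phi) x)%:E)%E).
  by congr fine; apply: eq_integral => x; rewrite inE => /fE ->.
rewrite integral_step_function//.
rewrite (eq_bigr (fun phi => (c phi * n%:R^-1 ^+ m)%:E)) => [|phi _]; last first.
  by rewrite (setIidl (BD' phi)) [X in (_ * X)%E]BE EFinM.
rewrite sumEFin /= -mulr_suml mulrC /hom_mean /mean card_ffun !card_ord.
by rewrite natrX exprVn.
Qed.

End hom_density.

(** * Weight of the graphs far from all constants *)

Section bad_graphs.
Variable R : realType.

Definition block_count K n (c : 'I_n -> 'I_K) (G : simple_graph n) (xy : 'I_K * 'I_K) : nat :=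
  #|[pred q : 'I_n * 'I_n | ((c q.1, c q.2) == xy) && adj G q.1 q.2]|.

Lemma block_meanE K n (c : 'I_n -> 'I_K) (G : simple_graph n) i j :
  block_mean c (@adjR R n G) i j =
  (fiber_card (fun p : 'I_n * 'I_n => (c p.1, c p.2)) (i, j))%:R^-1 *
    (block_count c G (c i, c j))%:R.
Proof.
rewrite /block_mean /cond_mean; congr (_ * _); rewrite /block_count -sum1_card natr_sum.
rewrite big_mkcond [RHS]big_mkcond; apply: eq_bigr => q _ /=; rewrite /adjR inE.
by case: ifP => //= _; case: (adj _ _ _).
Qed.

Lemma block_count_lt K n (c : 'I_n -> 'I_K) (G : simple_graph n) xy :
  (block_count c G xy < (n ^ 2).+1)%N.
Proof. by rewrite ltnS (leq_trans (max_card _))// card_prod card_ord mulnn. Qed.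

(** A colouring together with its block edge counts: there are only
    [exp (O n)] of these, and they determine the block averages. *)
Definition profile K n (c : 'I_n -> 'I_K) (G : simple_graph n) :
    {ffun 'I_n -> 'I_K} * {ffun 'I_K * 'I_K -> 'I_(n ^ 2).+1} :=
  ([ffun i => c i], [ffun xy => Ordinal (block_count_lt c G xy)]).

Lemma profile_block_mean K n (c c' : 'I_n -> 'I_K) (G G' : simple_graph n) :
  profile c G = profile c' G' -> block_mean c (@adjR R n G) = block_mean c' (@adjR R n G').
Proof.
move=> [/ffunP cc /ffunP bb].
have cE i : c i = c' i by have := cc i; rewrite !ffunE.
have bE xy : block_count c G xy = block_count c' G' xy.
  by have := bb xy; rewrite !ffunE => -[].
have pE : (fun p : 'I_n * 'I_n => (c p.1, c p.2)) = (fun p => (c' p.1, c' p.2)).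
  by apply/funext => p; rewrite !cE.
by apply/funext => i; apply/funext => j; rewrite !block_meanE pE !cE bE.
Qed.

Lemma card_profile_le K n :
  #|{: {ffun 'I_n -> 'I_K} * {ffun 'I_K * 'I_K -> 'I_(n ^ 2).+1}}|%:R
  <= expR ((K + 2 * K ^ 2)%N%:R * n%:R) :> R.
Proof.
rewrite card_prod !card_ffun card_prod !card_ord mulnn natrM !natrX natrD mulrDl expRD.
have leE (m : nat) : m%:R <= expR m%:R :> R.
  by rewrite (le_trans _ (expR_ge1Dx _))// lerDr.
rewrite ler_pM ?exprn_ge0//.
  by rewrite mulrC expRM_natl lerXn2r ?nnegrE ?expR_ge0.
have -> : (2 * K ^ 2)%:R * n%:R = (K * K)%N%:R * (2 * n%:R) :> R by rewrite natrM -mulnn; ring.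
rewrite !expRM_natl lerXn2r ?nnegrE ?exprn_ge0 ?expR_ge0//.
rewrite (@le_trans _ _ ((1 + n%:R) ^+ 2))//.
  by rewrite -natr1 natrX; have : 0 <= n%:R :> R by []; nra.
by rewrite lerXn2r ?nnegrE ?expR_ge0 ?addr_ge0// expR_ge1Dx.
Qed.

Lemma sum_edge_law_profile_le K n (c : simple_graph n -> 'I_n -> 'I_K) :
  \sum_(G : simple_graph n) edge_law (block_mean (c G) (@adjR R n G)) G
  <= expR ((K + 2 * K ^ 2)%N%:R * n%:R).
Proof.
apply: le_trans (card_profile_le K n).
rewrite (partition_big (fun G => profile (c G) G) predT)//= -sum1_card natr_sum.
apply: ler_sum => i _.
have [[G0 /eqP G0i]|noG] := pselect (exists G, profile (c G) G == i); last first.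
  by rewrite big1// => G Gi; exfalso; apply: noG; exists G.
rewrite -(edge_law_sum1 (block_mean (c G0) (@adjR R n G0))) big_mkcond /=.
have W01 G i' j : 0 <= block_mean (c G) (@adjR R n G) i' j <= 1.
  by apply: cond_mean_unit => p; exact: adjR01.
apply: ler_sum => G _; case: eqP => [Gi|_]; last exact: edge_law_ge0.
by rewrite (@profile_block_mean _ _ (c G) (c G0) G G0) ?Gi.
Qed.

Lemma cut_leD n (D1 D2 : 'I_n -> 'I_n -> R) a b : cut_le D1 a -> cut_le D2 b ->
  cut_le (fun i j => D1 i j + D2 i j) (a + b).
Proof.
move=> D1a D2b f g f01 g01.
have -> : mean (fun i => mean (fun j => (D1 i j + D2 i j) * (f i * g j))) =
    mean (fun i => mean (fun j => D1 i j * (f i * g j))) +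
    mean (fun i => mean (fun j => D2 i j * (f i * g j))).
  rewrite -meanD; apply: eq_mean => i; rewrite -meanD; apply: eq_mean => j.
  by rewrite mulrDl.
by rewrite (le_trans (ler_normD _ _))// lerD ?D1a ?D2b.
Qed.

Lemma cut_le_mean_norm n (D : 'I_n -> 'I_n -> R) a :
  mean (fun q => `|D q.1 q.2|) <= a -> cut_le D a.
Proof.
move=> Da f g f01 g01; apply: le_trans Da.
rewrite -(mean_fun_pair (fun i j => D i j * (f i * g j))).
apply: le_trans (ler_norm_mean _) _; apply: ler_mean => q; rewrite normrM ler_piMr//.
have /andP[f0 f1] := f01 q.1; have /andP[g0 g1] := g01 q.2.
by rewrite ger0_norm ?mulr_ge0// mulr_ile1.
Qed.

Variables (k : nat) (H : 'I_k.+1 -> finite_graph) (beta : 'I_k.+1 -> R).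
Hypotheses (H0 : nedges (H ord0) = 1%N) (H_edge : forall i, (0 < nedges (H i))%N)
  (beta_ge0 : forall i, i != ord0 -> 0 <= beta i).

Definition mean_statistic n (G : simple_graph n) : R :=
  \sum_(i < k.+1) beta i * hom_mean (H i) (adjR R G).

(** Approximate each graph by its block averages [W]: the energy of the graph
    is that of [W] up to the counting lemma, its entropic cost is paid by
    [edge_law W], and [W] cannot be a near-maximizer of the mean-field
    functional since the graph is far from all constants in [U]. *)
Lemma sum_far_graphs_le (u0 : R) (e : R) : is_max H beta u0 -> 0 < e ->
  exists2 delta, 0 < delta & exists C, forall n, (0 < n)%N -> forall B : pred (simple_graph n),
    (forall G, B G -> forall u, is_max H beta u -> ~ cut_le (fun i j => adjR R G i j - u) e) ->
    \sum_(G | B G) expR (n%:R ^+ 2 * mean_statistic G) <=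
    expR (n%:R ^+ 2 * (scalar_objective H beta u0 - delta) + C * n%:R).
Proof.
move=> u0max e0; set L := scalar_objective H beta u0.
have e20 : 0 < e / 2 by rewrite divr_gt0.
have Lmax v : 0 <= v <= 1 -> scalar_objective H beta v <= L by case: u0max => _; apply.
have U01 u : [set u | is_max H beta u] u -> 0 <= u <= 1 by move=> [].
have near_U (r : R) : 0 < r -> exists2 kappa, 0 < kappa & forall v, 0 <= v <= 1 ->
    L - scalar_objective H beta v < kappa ->
    exists2 u, [set u | is_max H beta u] u & `|v - u| < r.
  by move=> r0; apply: near_max_near_is_max => //; exists u0.
have cases : (exists i, 0 < beta i /\ (2 <= nedges (H i))%N) \/
    (forall u v, [set u | is_max H beta u] u -> [set u | is_max H beta u] v -> u = v).
  have [?|nlin] := pselect (exists i, 0 < beta i /\ (2 <= nedges (H i))%N); [by left|right].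
  by move=> u v; exact: (is_max_unique H0 H_edge beta_ge0 nlin).
have [d0 d00 dP] := near_maximizer_near_constant H0 H_edge beta_ge0 Lmax U01 near_U cases e20.
pose C1 := \sum_(i < k.+1) `|beta i| * (nedges (H i))%:R.
have C10 : 0 <= C1 by apply: sumr_ge0 => i _; rewrite mulr_ge0.
pose eps := Num.min (e / 2) (d0 / 2 / (C1 + 1)).
have C1p : 0 < C1 + 1 by rewrite ltr_wpDl.
have eps0 : 0 < eps by rewrite lt_min e20 !divr_gt0.
have eps_e : eps <= e / 2 by rewrite ge_min lexx.
have eps_d : C1 * eps <= d0 / 2.
  apply: (@le_trans _ _ ((C1 + 1) * eps)); first by rewrite ler_wpM2r ?(ltW eps0)// lerDl.
  by rewrite mulrC -ler_pdivlMr// ge_min lexx orbT.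
have [K reg] := weak_regularity eps0.
exists (d0 / 2); first by rewrite divr_gt0.
exists (K + 2 * K ^ 2)%N%:R => n n0 B Bfar.
have n0' : 0 < n%:R :> R by rewrite ltr0n.
pose c (G : simple_graph n) := sval (cid (reg n (adjR R G) n0 (adjR01 R G))).
have cP G : cut_le (fun i j => adjR R G i j - block_mean (c G) (adjR R G) i j) eps.
  by rewrite /c; case: cid.
rewrite expRD.
apply: (@le_trans _ _ (\sum_G expR (n%:R ^+ 2 * (L - d0 / 2)) *
    edge_law (block_mean (c G) (@adjR R n G)) G)); last first.
  by rewrite -mulr_sumr ler_wpM2l ?expR_ge0// sum_edge_law_profile_le.
rewrite big_mkcond; apply: ler_sum => G _; set W := block_mean (c G) _.
have W01 i j : 0 <= W i j <= 1 by apply: cond_mean_unit => p; exact: adjR01.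
have Ws i j : W i j = W j i by apply: block_mean_sym; exact: adjR_sym.
case: ifP => BG; last by rewrite mulr_ge0 ?expR_ge0// edge_law_ge0.
apply: (@le_trans _ _ (expR (n%:R ^+ 2 * (L - d0 / 2)) * expR (\sum_p rate (W p.1 p.2)))); last first.
  by rewrite ler_wpM2l ?expR_ge0// expR_rate_le_edge_law.
rewrite -expRD ler_expR.
have -> : \sum_p rate (W p.1 p.2) = n%:R ^+ 2 * mean (fun q => rate (W q.1 q.2)).
  rewrite /mean card_prod card_ord natrM mulrA; set S := \sum_p _.
  by field; rewrite gt_eqF.
rewrite -mulrDr ler_pM2l ?exprn_gt0//.
have far : \sum_(i < k.+1) beta i * hom_mean (H i) W - mean (fun q => rate (W q.1 q.2)) < L - d0.
  rewrite ltNge; apply/negP => /(dP n W n0 W01 Ws)[u um uW].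
  apply: (Bfar G BG u um) => f g f01 g01.
  have h := cut_leD (cP G) (@cut_le_mean_norm n (fun i j => W i j - u) _ uW) f01 g01.
  apply: le_trans (_ : eps + e / 2 <= e); last by move: eps_e; lra.
  rewrite (_ : mean _ = mean (fun i => mean (fun j =>
    (adjR R G i j - block_mean (c G) (adjR R G) i j + (W i j - u)) * (f i * g j))))//.
  by apply: eq_mean => i; apply: eq_mean => j; rewrite -/W addrA subrK.
have count : mean_statistic G - \sum_(i < k.+1) beta i * hom_mean (H i) W <= C1 * eps.
  rewrite /mean_statistic -sumrB /C1 mulr_suml; apply: ler_sum => i _.
  rewrite -mulrBr (le_trans (ler_norm _))// normrM -mulrA ler_wpM2l// -card_edge_pairs.
  by apply: counting_lemma => // i' j; exact: adjR01.
by move: far count eps_d; move: (mean_statistic G) (mean _) (\sum_(i < k.+1) beta i * _) (C1 * eps) => ? ? ? ?; lra.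
Qed.

End bad_graphs.

(** * Concentration of the random graph *)

Section probability.
Variable R : realType.

Lemma cut_metric_le (f g : graphon R) : cut_metric (tilde f) (tilde g) <= cut_dist f g.
Proof.
rewrite cut_metric_tilde; apply: ge_inf; first by exists 0 => _ [s _ <-]; exact: cut_dist_ge0.
by exists (mp_id R); rewrite ?relabel_id.
Qed.

Lemma cut_metric_ge0 (f g : graphon R) : 0 <= cut_metric (tilde f) (tilde g).
Proof.
rewrite cut_metric_tilde; apply: lb_le_inf => [|_ [s _ <-]]; last exact: cut_dist_ge0.
by exists (cut_dist f (relabel g (mp_id R))), (mp_id R).
Qed.

Variables (k : nat) (H : 'I_k.+1 -> finite_graph) (beta : 'I_k.+1 -> R).

Lemma statistic_graph_graphon n (G : simple_graph n) : (0 < n)%N ->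
  statistic H beta (graph_graphon R G) = mean_statistic H beta G.
Proof. by move=> n0; apply: eq_bigr => i _; rewrite hom_density_graph. Qed.

Lemma maximizersP (u : {i01 R}) : maximizers H beta u <-> is_max H beta u%:num.
Proof.
split=> [um|[_ um] v]; last by apply: um; rewrite ge0 le1.
split=> [|v /andP[v0 v1]]; first by rewrite ge0 le1.
exact: (um (Itv01 v0 v1)).
Qed.

Lemma finite_maximizers : finite_set (maximizers H beta).
Proof.
have inj : {in maximizers H beta &, injective (fun u : {i01 R} => u%:num)}.
  by move=> u v _ _ /val_inj.
rewrite -(eq_finite_set (inj_card_eq inj)).
apply: sub_finite_set (finite_is_max H beta) => _ [u /maximizersP um <-].
exact: um.
Qed.

Lemma maximizers_nonempty : maximizers H beta !=set0.
Proof.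
have [u um] := ex_is_max H beta; have [/andP[u0 u1] _] := um.
by exists (Itv01 u0 u1); apply/maximizersP.
Qed.

Section one_size.
Variables (n : nat) (d : measure_display) (Omega : measurableType d)
  (P : probability Omega R) (G : Omega -> simple_graph n).
Hypotheses (n_gt0 : (0 < n)%N) (G_ergm : exponential_random_graph H beta P G).

Local Notation Z := (\sum_(g : simple_graph n) expR (n%:R ^+ 2 * mean_statistic H beta g)).

Lemma ergm_prob (g : simple_graph n) :
  P (G @^-1` [set g]) = (expR (n%:R ^+ 2 * mean_statistic H beta g) / Z)%:E.
Proof.
have n0' : 0 < n%:R :> R by rewrite ltr0n.
have Z0 : 0 < Z.
  by rewrite (bigD1 g)//= ltr_pwDl ?expR_gt0// sumr_ge0// => *; exact: expR_ge0.
have [_ ->] := G_ergm g; congr EFin.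
rewrite statistic_graph_graphon// mulrBr expRD expRN; congr (_ / _).
rewrite /normalizing_constant mulrA mulfV ?mul1r; last by rewrite expf_neq0 ?gt_eqF.
rewrite (eq_bigr (fun g => expR (n%:R ^+ 2 * mean_statistic H beta g))); last first.
  by move=> h _; rewrite statistic_graph_graphon.
by rewrite lnK.
Qed.

Lemma ergm_event_prob_le (B : pred (simple_graph n)) :
  (P [set w | B (G w)] <=
   ((\sum_(g | B g) expR (n%:R ^+ 2 * mean_statistic H beta g)) / Z)%:E)%E.
Proof.
pose ev (s : seq (simple_graph n)) := \big[setU/set0]_(g <- s) (G @^-1` [set g]).
have mg g : measurable (G @^-1` [set g]) by have [] := G_ergm g.
have mev s : measurable (ev s) by apply: bigsetU_measurable => g _; exact: mg.
have le s : (P (ev s) <= (\sum_(g <- s) expR (n%:R ^+ 2 * mean_statistic H beta g) / Z)%:E)%E.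
  elim: s => [|g s IH]; first by rewrite /ev !big_nil measure0.
  rewrite /ev !big_cons -/(ev s) EFinD.
  apply: le_trans (measureU2 _ _ (mev s)) _ => //.
  by apply: leeD IH; rewrite [X in (X <= _)%E]ergm_prob.
have := le (enum B); rewrite big_enum /= -mulr_suml.
rewrite (_ : ev (enum B) = [set w | B (G w)])//.
apply/seteqP; split => w; rewrite /ev -bigcup_seq /=.
  by move=> [g /=]; rewrite mem_enum => Bg ->.
by move=> Bw; exists (G w); rewrite //= mem_enum.
Qed.

End one_size.

Hypotheses (H0 : nedges (H ord0) = 1%N) (H_edge : forall i, (0 < nedges (H i))%N)
  (beta_ge0 : forall i, i != ord0 -> 0 <= beta i).

(** The partition function is at least [expR (n ^ 2 L - O(n))] while the far
    graphs contribute at most [expR (n ^ 2 (L - delta) + O(n))]. *)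
Lemma ergm_far_prob_le (e : R) : 0 < e -> exists2 delta, 0 < delta & exists C,
  forall (n : nat) (d : measure_display) (Omega : measurableType d)
    (P : probability Omega R) (G : Omega -> simple_graph n) (B : pred (simple_graph n)),
  (0 < n)%N -> exponential_random_graph H beta P G ->
  (forall g, B g -> forall u, maximizers H beta u ->
     e < cut_dist (graph_graphon R g) (const_graphon u)) ->
  (P [set w | B (G w)] <= (expR (C * n%:R - delta * n%:R ^+ 2))%:E)%E.
Proof.
move=> e0; have [u0 u0max] := ex_is_max H beta.
have [delta delta0 [C1 far]] := sum_far_graphs_le H0 H_edge beta_ge0 u0max e0.
have [u001 _] := u0max; have [C2 low] := partition_function_ge H beta u001.
exists delta => //; exists (C1 + C2) => n d Omega P G B n0 ergm Bfar.
apply: le_trans (ergm_event_prob_le n0 ergm B) _; rewrite lee_fin.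
set Z := \sum_(g : simple_graph n) _.
have Zlow : expR (n%:R ^+ 2 * scalar_objective H beta u0 - C2 * n%:R) <= Z by exact: low.
have Z0 : 0 < Z by rewrite (lt_le_trans _ Zlow) ?expR_gt0.
rewrite ler_pdivrMr//; apply: le_trans (ler_wpM2l (expR_ge0 _) Zlow).
rewrite -expRD.
have -> : (C1 + C2) * n%:R - delta * n%:R ^+ 2 +
    (n%:R ^+ 2 * scalar_objective H beta u0 - C2 * n%:R) =
    n%:R ^+ 2 * (scalar_objective H beta u0 - delta) + C1 * n%:R by ring.
apply: far => // g Bg u um cut; have [/andP[u0' u1'] _] := um.
have /Bfar - /(_ (Itv01 u0' u1')) := Bg.
rewrite ltNge (cut_dist_const_le n0)// => /(_ _)/negP; apply => //.
exact/maximizersP.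
Qed.

(** Once [delta n] exceeds [C + 1], the exponent is at most [- n]. *)
Lemma cvg_expR_quadratic (C delta : R) : 0 < delta ->
  (expR (C * n%:R - delta * n%:R ^+ 2))%:E @[n --> \oo] --> 0%E.
Proof.
move=> delta0; apply: cvg_EFin; first by near=> n.
rewrite /comp /=; apply: (@squeeze_cvgr _ _ _ _ (fun _ => 0) (@harmonic R)).
- near=> n; rewrite expR_ge0 /= /harmonic.
  have nC : (C + 1) / delta <= n%:R by near: n; exact: nbhs_infty_ger.
  apply: (@le_trans _ _ (expR (- n%:R))).
    rewrite ler_expR; move: nC; rewrite ler_pdivrMr// => nC.
    have := ler_wpM2r (ler0n R n) nC; lra.
  rewrite expRN lef_pV2 ?posrE ?expR_gt0 ?ltr0n//.
  by rewrite -natr1 addrC expR_ge1Dx.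
- exact: cvg_cst.
- exact: cvg_harmonic.
Unshelve. all: by end_near.
Qed.

(** Common to both parts of the theorem: all that matters is to be below the
    cut distance to each maximizer. *)
Lemma ergm_cvg0_in_probability (d : nat -> measure_display)
    (Omega : forall n, measurableType (d n)) (P : forall n, probability (Omega n) R)
    (G : forall n, Omega n -> simple_graph n) (Y : forall n, simple_graph n -> R) :
  (forall n, (0 < n)%N -> exponential_random_graph H beta (P n) (@G n)) ->
  (forall n (g : simple_graph n), 0 <= Y n g) ->
  (forall n (g : simple_graph n) u, maximizers H beta u ->
     Y n g <= cut_dist (graph_graphon R g) (const_graphon u)) ->
  cvg0_in_probability P (fun n w => Y n (G n w)).
Proof.
move=> ergm Y0 Yle e e0; have [delta delta0 [C le]] := ergm_far_prob_le e0.
apply: (@squeeze_cvge _ _ _ _ (fun _ => 0%E) _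
  (fun n => (expR (C * n%:R - delta * n%:R ^+ 2))%:E)).
- near=> n; rewrite measure_ge0 /=.
  have n0 : (0 < n)%N by near: n; exists 1%N.
  apply: (le n _ _ (P n) (@G n) (fun g => e < `|Y n g|) n0 (ergm n n0)) => g eY u um.
  by apply: lt_le_trans eY _; rewrite ger0_norm// Yle.
- exact: cvg_cst.
- exact: cvg_expR_quadratic.
Unshelve. all: by end_near.
Qed.

End probability.

Theorem theorem4p2 (R : realType) (k : nat)
    (H : 'I_k.+1 -> finite_graph) (beta : 'I_k.+1 -> R)
    (H1 : H ord0 = complete_graph 2)
    (H_edge : forall i, (0 < nedges (H i))%N)
    (beta_ge0 : forall i, i != ord0 -> 0 <= beta i)
    (d : nat -> measure_display) (Omega : forall n, measurableType (d n))
    (P : forall n, probability (Omega n) R)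
    (G : forall n, Omega n -> simple_graph n)
    (G_ergm : forall n, (0 < n)%N -> exponential_random_graph H beta (P n) (@G n)) :
  let U := maximizers H beta in
  let Gtilde n (w : Omega n) := tilde (graph_graphon R (G n w)) in
  let utilde (u : {i01 R}) := tilde (const_graphon u) in
  (forall u : {i01 R}, U = [set u] ->
     cvg0_in_probability P (fun n w => cut_metric (Gtilde n w) (utilde u))) /\
  [/\ finite_set U, U !=set0 &
     cvg0_in_probability P
       (fun n w => inf [set cut_metric (Gtilde n w) (utilde u) | u in U])].
Proof.
have H0 : nedges (H ord0) = 1%N.
  by rewrite H1; apply: etrans (card_draws _ 2) _; rewrite card_ord.
have cvg := ergm_cvg0_in_probability H0 H_edge beta_ge0.
move=> U Gtilde utilde; split=> [u Uu|]; last split.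
- apply: (cvg _ _ _ _ (fun n g => cut_metric (tilde (graph_graphon R g)) (utilde u))) => //.
    by move=> n g; exact: cut_metric_ge0.
  by move=> n g v; rewrite -/U Uu => ->; exact: cut_metric_le.
- exact: finite_maximizers.
- exact: maximizers_nonempty.
apply: (cvg _ _ _ _ (fun n g =>
  inf [set cut_metric (tilde (graph_graphon R g)) (utilde u) | u in U])) => // n g.
  have [u0 Uu0] := maximizers_nonempty H beta.
  apply: lb_le_inf => [|_ [u _ <-]]; last exact: cut_metric_ge0.
  by exists (cut_metric (tilde (graph_graphon R g)) (utilde u0)), u0.
move=> u Uu; apply: le_trans (cut_metric_le _ _); apply: ge_inf; last by exists u.
by exists 0 => _ [v _ <-]; exact: cut_metric_ge0.
Qed.
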